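(* Let $H$ be a colour Hopf algebra, $A$ a graded $H$-comodule colour algebra, and set $B=A^{coH}$. Assume that there is a graded $H$-colinear map $\theta:H\to A$ such that $\theta(1_H)=1_A$. Then the functor $$F=A\otimes_B-:{}_{\mathrm{gr}\text{-}B}\mathcal M\to{}_{\mathrm{gr}\text{-}A}^{\mathrm{gr}\text{-}H}\mathcal M$$ is Maschke, that is, every object of ${}_{\mathrm{gr}\text{-}B}\mathcal M$ is $F$-relative injective. If furthermore $\theta$ is a colour algebra map, then the functor $$G=(-)^{coH}:{}_{\mathrm{gr}\text{-}A}^{\mathrm{gr}\text{-}H}\mathcal M\to{}_{\mathrm{gr}\text{-}B}\mathcal M$$ is dual Maschke, that is, every object of ${}_{\mathrm{gr}\text{-}A}^{\mathrm{gr}\text{-}H}\mathcal M$ is $G$-relative projective.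
   Context: $\Bbbk$ is a field and $G$ is a multiplicative abelian group (the grading group; not to be confused with the functor $G$) with identity $e$ and a bicharacter $(\cdot/\cdot):G\times G\to\Bbbk^{\times}$, i.e. $(g/g'g'')=(g/g')(g/g'')$ and $(gg'/g'')=(g/g'')(g'/g'')$. ''Graded'' means $G$-graded; $|m|$ is the degree of a homogeneous element $m$; formulas are written for homogeneous elements and extended linearly. A graded map $f:M\to N$ is a $\Bbbk$-linear map with $f(M_g)\subseteq N_g$ for all $g$. $\otimes=\otimes_{\Bbbk}$, graded by $(M\otimes N)_g=\bigoplus_{g'g''=g}M_{g'}\otimes N_{g''}$; $\Bbbk$ is in degree $e$. A colour algebra is a $G$-graded associative unital $\Bbbk$-algebra; a colour algebra map is a graded map that is a unital $\Bbbk$-algebra homomorphism. A colour Hopf algebra $H$ is a colour algebra which is also a (coassociative, counital) coalgebra with graded maps $\Delta_H$, $\varepsilon_H$ (write $\Delta_H(h)=h_1\otimes h_2$ with homogeneous components), such that $\varepsilon_H$ is a unital algebra map, $\Delta_H(1_H)=1_H\otimes 1_H$, $\Delta_H(hh')=(|h_2|/|h'_1|)\,h_1h'_1\otimes h_2h'_2$, and with a graded map $\mathcal S_H:H\to H$ (antipode) satisfying $h_1\mathcal S_H(h_2)=\varepsilon_H(h)1_H=\mathcal S_H(h_1)h_2$. A graded $H$-comodule is a graded vector space $M$ with a graded map $\chi_M:M\to H\otimes M$, $\chi_M(m)=m_{(-1)}\otimes m_{(0)}$, which is coassociative and counital (left comodule). $H$ is a graded $H$-comodule via $\Delta_H$.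 A graded $H$-colinear map is a graded map $f$ with $f(m)_{(-1)}\otimes f(m)_{(0)}=m_{(-1)}\otimes f(m_{(0)})$. Coinvariants: $M^{coH}=\{m\in M:\chi_M(m)=1_H\otimes m\}$, a graded subspace. A graded $H$-comodule colour algebra is a colour algebra $A$ that is a graded $H$-comodule with $\chi_A(1_A)=1_H\otimes 1_A$ and $\chi_A(aa')=(|a_{(0)}|/|a'_{(-1)}|)\,a_{(-1)}a'_{(-1)}\otimes a_{(0)}a'_{(0)}$. For a colour algebra $R$, ${}_{\mathrm{gr}\text{-}R}\mathcal M$ is the category of graded left $R$-modules ($R_gM_{g'}\subseteq M_{gg'}$) with graded $R$-linear maps. A colour $(A,H)$-Hopf module is a graded left $A$-module and graded $H$-comodule $M$ (same grading) with $\chi_M(am)=(|a_{(0)}|/|m_{(-1)}|)\,a_{(-1)}m_{(-1)}\otimes a_{(0)}m_{(0)}$; ${}_{\mathrm{gr}\text{-}A}^{\mathrm{gr}\text{-}H}\mathcal M$ is the category of these, with graded $A$-linear graded $H$-colinear maps. $B=A^{coH}$ is a graded subalgebra of $A$ and $M^{coH}$ is a graded left $B$-module. For a graded left $B$-module $N$, $A\otimes_B N$ is a colour $(A,H)$-Hopf module via $a(a'\otimes_B n)=(aa')\otimes_B n$ and $\chi(a\otimes_B n)=a_{(-1)}\otimes a_{(0)}\otimes_B n$. For a functor $F:\mathcal C\to\mathcal D$, an object $I$ of $\mathcal C$ is $F$-relative injective if for every morphism $i:X\to Y$ in $\mathcal C$ such that $F(i)$ has a left inverse in $\mathcal D$ and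 every $f:X\to I$ there is $g:Y\to I$ with $g\circ i=f$. For a functor $G:\mathcal D\to\mathcal C$, an object $P$ of $\mathcal D$ is $G$-relative projective if for every morphism $p:X\to Y$ in $\mathcal D$ such that $G(p)$ has a right inverse in $\mathcal C$ and every $f:P\to Y$ there is $g:P\to X$ with $p\circ g=f$. *)

(* Defs.v *)
From HB Require Import structures.
From mathcomp Require Import all_boot all_order all_algebra.
From mathcomp Require Import boolp.

Set Implicit Arguments.
Unset Strict Implicit.
Unset Printing Implicit Defensive.

Import GRing.Theory.
Local Open Scope ring_scope.
Local Open Scope quotient_scope.

Section LinearMaps.
Variable k : fieldType.

Definition bilin (U V W : lmodType k) (f : U -> V -> W) : Prop :=
  (forall v, linear (f^~ v)) /\ (forall u, linear (f u)).

Definition linear_of (U V : lmodType k) (f : U -> V) (Hf : linear f) :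
    {linear U -> V} :=
  HB.pack f (GRing.isLinear.Build k U V *:%R f Hf).

Lemma linear_ofE (U V : lmodType k) (f : U -> V) (Hf : linear f) u :
  linear_of Hf u = f u.
Proof. by []. Qed.

Lemma linear_eq (U V : lmodType k) (f g : {linear U -> V}) : f =1 g -> f = g.
Proof.
case: f g => f [[f1] [f2]] [g [[g1] [g2]]] /= /funext E.
case: _ / E in g1 g2 *.
by rewrite (Prop_irrelevance f1 g1) (Prop_irrelevance f2 g2).
Qed.

Lemma linE (U V : lmodType k) (f : U -> V) : linear f ->
  [/\ f 0 = 0, {morph f : x y / x + y} & forall c, {morph f : x / c *: x}].
Proof.
move=> Hf; split.
- exact: (linear0 (linear_of Hf)).
- exact: (linearD (linear_of Hf)).
- by move=> c x; rewrite -(linear_ofE Hf) linearZ.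
Qed.

End LinearMaps.

Section Tensor.
Variables (k : fieldType) (M N : lmodType k).
(* The maps ra and la stand for a right action on M and a left action on N of
   the elements of I; the quotient identifies (ra i m) ⊗ n with m ⊗ (la i n).
   For I empty this is M ⊗_k N, for I = B acting on both sides it is M ⊗_B N. *)
Variables (I : Type) (ra : I -> M -> M) (la : I -> N -> N).

Definition fscale (c : k) (s : seq (M * N)) : seq (M * N) :=
  [seq (c *: p.1, p.2) | p <- s].

(* A sequence of pairs is a formal sum of pure tensors. *)
Inductive tens_eq : seq (M * N) -> seq (M * N) -> Prop :=
| te_refl s : tens_eq s s
| te_sym s t : tens_eq s t -> tens_eq t s
| te_trans s t u : tens_eq s t -> tens_eq t u -> tens_eq s u
| te_cat s s' t t' : tens_eq s s' -> tens_eq t t' ->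
    tens_eq (s ++ t) (s' ++ t')
| te_scale c s t : tens_eq s t -> tens_eq (fscale c s) (fscale c t)
| te_comm s t : tens_eq (s ++ t) (t ++ s)
| te_Dl m m' n : tens_eq [:: (m + m', n)] [:: (m, n); (m', n)]
| te_Dr m n n' : tens_eq [:: (m, n + n')] [:: (m, n); (m, n')]
| te_Z c m n : tens_eq [:: (c *: m, n)] [:: (m, c *: n)]
| te_0 n : tens_eq [:: (0, n)] [::]
| te_bal i m n : tens_eq [:: (ra i m, n)] [:: (m, la i n)].

Definition tens_eqb (s t : seq (M * N)) : bool := `[< tens_eq s t >].

Lemma tens_eqb_equiv : equiv_class_of tens_eqb.
Proof.
split=> [s|s t|t s u].
- exact/asboolP/te_refl.
- by apply/asboolP/asboolP; apply: te_sym.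
- by move=> /asboolP st /asboolP tu; apply/asboolP; apply: te_trans st tu.
Qed.

Canonical tens_equiv := EquivRelPack tens_eqb_equiv.

Definition btensor := {eq_quot tens_equiv}.
HB.instance Definition _ := Choice.on btensor.
HB.instance Definition _ := EqQuotient.on btensor.

Let tpi (s : seq (M * N)) : btensor := \pi_btensor s.

Let tpiP s t : tpi s = tpi t <-> tens_eq s t.
Proof.
split; first by move=> /eqquotP/asboolP.
by move=> st; apply/eqquotP/asboolP.
Qed.

Let reprP s : tens_eq (repr (tpi s)) s.
Proof. by apply/tpiP; rewrite /tpi reprK. Qed.

Definition tadd (x y : btensor) : btensor := \pi_btensor (repr x ++ repr y).
Definition tzero : btensor := \pi_btensor [::].
Definition tscale (c : k) (x : btensor) : btensor := \pi_btensor (fscale c (repr x)).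
Definition topp (x : btensor) : btensor := tscale (- 1) x.

Let taddE s t : tadd (tpi s) (tpi t) = tpi (s ++ t).
Proof. by apply/tpiP/te_cat; apply: reprP. Qed.

Let tscaleE c s : tscale c (tpi s) = tpi (fscale c s).
Proof. by apply/tpiP/te_scale; apply: reprP. Qed.

Let tW (P : btensor -> Prop) : (forall s, P (tpi s)) -> forall t, P t.
Proof. by move=> H t; rewrite -[t]reprK; apply: H. Qed.

Let taddA : associative tadd.
Proof.
elim/tW=> s; elim/tW=> t; elim/tW=> u.
by rewrite !taddE catA.
Qed.

Let taddC : commutative tadd.
Proof. by elim/tW=> s; elim/tW=> t; rewrite !taddE; apply/tpiP/te_comm. Qed.

Let tadd0 : left_id tzero tadd.
Proof. by elim/tW=> s; rewrite /tzero taddE. Qed.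

Let fscale0 s : tens_eq (fscale 0 s) [::].
Proof.
elim: s => [|[m n] s IH]; first exact: te_refl.
rewrite /= scale0r -cat1s -[[::]]/([::] ++ [::]).
by apply: te_cat IH; apply: te_0.
Qed.

Let fscaleD a b s : tens_eq (fscale (a + b) s) (fscale a s ++ fscale b s).
Proof.
elim: s => [|[m n] s IH]; first exact: te_refl.
rewrite /= scalerDl -cat1s.
apply: te_trans (te_cat (te_Dl _ _ _) IH) _.
rewrite -[(a *: m, n) :: (_ ++ _)]cat1s -[(_, n) :: fscale b s]cat1s.
rewrite -[[:: _; _]]cat1s -!catA.
apply: te_cat; first exact: te_refl.
rewrite !catA; apply: te_cat; last exact: te_refl.
exact: te_comm.
Qed.

Let fscale1 s : fscale 1 s = s.
Proof. by rewrite -[RHS]map_id; apply: eq_map => -[m n] /=; rewrite scale1r. Qed.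

Let tscaleA a b v : tscale a (tscale b v) = tscale (a * b) v.
Proof.
elim/tW: v => s; rewrite !tscaleE /fscale -map_comp; congr (tpi _).
by apply: eq_map => -[m n] /=; rewrite scalerA.
Qed.

Let tscale1 : left_id 1 tscale.
Proof. by elim/tW=> s; rewrite tscaleE fscale1. Qed.

Let tscaleDr : right_distributive tscale tadd.
Proof.
by move=> c; elim/tW=> s; elim/tW=> t; rewrite !(taddE, tscaleE) /fscale map_cat.
Qed.

Let tscaleDl v : {morph tscale^~ v : a b / a + b >-> tadd a b}.
Proof.
by move=> a b; elim/tW: v => s; rewrite !(taddE, tscaleE); apply/tpiP/fscaleD.
Qed.

Let taddN : left_inverse tzero topp tadd.
Proof.
elim/tW=> s; rewrite /topp tscaleE taddE /tzero; apply/tpiP.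
rewrite -[X in _ ++ X]fscale1; apply: te_trans (te_sym (fscaleD _ _ _)) _.
rewrite addNr; exact: fscale0.
Qed.

HB.instance Definition _ :=
  GRing.isZmodule.Build btensor taddA taddC tadd0 taddN.
HB.instance Definition _ :=
  GRing.Zmodule_isLmodule.Build k btensor tscaleA tscale1 tscaleDr tscaleDl.

Definition tens (m : M) (n : N) : btensor := \pi_btensor [:: (m, n)].

Lemma tens_bilin : bilin tens.
Proof.
have D m m' n : tens (m + m') n = tens m n + tens m' n.
  by rewrite [RHS]taddE; apply/tpiP/te_Dl.
have D' m n n' : tens m (n + n') = tens m n + tens m n'.
  by rewrite [RHS]taddE; apply/tpiP/te_Dr.
have Z c m n : tens (c *: m) n = c *: tens m n.
  by rewrite [RHS]tscaleE.
have Z' c m n : tens m (c *: n) = c *: tens m n.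
  by rewrite -Z; apply/esym/tpiP/te_Z.
by split=> [n c x y|m c x y]; rewrite (D, D') (Z, Z').
Qed.

Lemma tens_bal i m n : tens (ra i m) n = tens m (la i n).
Proof. by apply/tpiP/te_bal. Qed.

Lemma tens_sum (t : btensor) : t = \sum_(p <- repr t) tens p.1 p.2.
Proof.
rewrite -[LHS]reprK; elim: (repr t) => [|[m n] s IH]; first by rewrite big_nil.
by rewrite big_cons -IH [RHS]taddE.
Qed.

Lemma tens_ind (P : btensor -> Prop) :
  (forall m n, P (tens m n)) -> (forall x y, P x -> P y -> P (x + y)) ->
  forall t, P t.
Proof.
move=> P1 PD t; rewrite (tens_sum t); elim: (repr t) => [|p s IH].
  by rewrite big_nil; have [/= <- _ _] := linE (tens_bilin.1 0); apply: P1.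
by rewrite big_cons; apply: PD.
Qed.

Definition balanced (P : lmodType k) (f : M -> N -> P) : Prop :=
  bilin f /\ forall i m n, f (ra i m) n = f m (la i n).

(* The linear map sending m ⊗ n to f m n; it depends on the chosen
   representative of t unless f is balanced, which all maps used below are. *)
Definition teval (P : lmodType k) (f : M -> N -> P) (t : btensor) : P :=
  \sum_(p <- repr t) f p.1 p.2.

Section Teval.
Variables (P : lmodType k) (f : M -> N -> P) (bf : balanced f).

Let ev (s : seq (M * N)) : P := \sum_(p <- s) f p.1 p.2.

Let fD m m' n : f (m + m') n = f m n + f m' n.
Proof. by have [_ D _] := linE (bf.1.1 n); apply: D. Qed.
Let fD' m n n' : f m (n + n') = f m n + f m n'.
Proof. by have [_ D _] := linE (bf.1.2 m); apply: D. Qed.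
Let fZ c m n : f (c *: m) n = c *: f m n.
Proof. by have [_ _ Z] := linE (bf.1.1 n); apply: Z. Qed.
Let fZ' c m n : f m (c *: n) = c *: f m n.
Proof. by have [_ _ Z] := linE (bf.1.2 m); apply: Z. Qed.
Let f0 n : f 0 n = 0.
Proof. by have [Z _ _] := linE (bf.1.1 n); apply: Z. Qed.

Let evZ c s : ev (fscale c s) = c *: ev s.
Proof. by rewrite /ev big_map scaler_sumr; apply: eq_bigr => p _ /=. Qed.

Let ev_eq s t : tens_eq s t -> ev s = ev t.
Proof.
elim=> {s t} //=.
- by move=> s t u _ -> _ ->.
- by move=> s s' t t' _ Es _ Et; rewrite /ev !big_cat /=; congr (_ + _).
- by move=> c s t _ E; rewrite !evZ E.
- by move=> s t; rewrite /ev !big_cat /= addrC.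
- by move=> *; rewrite /ev !big_cons !big_nil /= !addr0.
- by move=> *; rewrite /ev !big_cons !big_nil /= !addr0.
- by move=> *; rewrite /ev !big_cons !big_nil /= !addr0 fZ fZ'.
- by move=> *; rewrite /ev !big_cons !big_nil /= f0 addr0.
- by move=> *; rewrite /ev !big_cons !big_nil /= !addr0 bf.2.
Qed.

Lemma tevalE m n : teval f (tens m n) = f m n.
Proof.
rewrite /teval -/(ev _) (ev_eq (reprP [:: (m, n)])).
by rewrite /ev big_cons big_nil addr0.
Qed.

Lemma teval_linear : linear (teval f).
Proof.
move=> c; elim/tW=> s; elim/tW=> t.
have E u : teval f (tpi u) = ev u by apply/ev_eq/reprP.
rewrite [c *: _]tscaleE [_ + _]taddE !E -evZ.
by rewrite /ev big_cat.
Qed.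

End Teval.

Lemma tens_ext (P : lmodType k) (f g : btensor -> P) :
  linear f -> linear g -> (forall m n, f (tens m n) = g (tens m n)) -> f =1 g.
Proof.
move=> /linE[_ fD _] /linE[_ gD _] E; apply: tens_ind => // x y Ex Ey.
by rewrite fD gD Ex Ey.
Qed.

End Tensor.

Arguments tens {k M N I ra la} m n.
Arguments teval {k M N I ra la P} f t.

(* The vacuous balancing condition, used for the tensor product over k. *)
Definition unbal (X : Type) (_ : void) (x : X) : X := x.

Notation "x ⊗ y" := (@tens _ _ _ void (@unbal _) (@unbal _) x y)
  (at level 40, left associativity) : ring_scope.

Section LinearClosure.
Variable k : fieldType.
Implicit Types U V W : lmodType k.

Lemma linear_comp U V W (g : V -> W) (f : U -> V) :
  linear g -> linear f -> linear (fun x => g (f x)).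
Proof. by move=> lg lf c x y; rewrite lf lg. Qed.

Lemma linear_sumf U V (J : Type) (r : seq J) (f : J -> U -> V) :
  (forall j, linear (f j)) -> linear (fun x => \sum_(j <- r) f j x).
Proof.
move=> lf c x y; rewrite scaler_sumr -big_split; apply: eq_bigr => j _.
exact: lf.
Qed.

Lemma linear_scalef U V (a : k) (f : U -> V) :
  linear f -> linear (fun x => a *: f x).
Proof. by move=> lf c x y; rewrite lf scalerDr !scalerA mulrC. Qed.

Lemma bilin_comp U U' V V' W (f : U' -> V' -> W) (g : U -> U') (h : V -> V') :
  bilin f -> linear g -> linear h -> bilin (fun x y => f (g x) (h y)).
Proof. by move=> [f1 f2] lg lh; split=> z c x y; rewrite (lg, lh) (f1, f2). Qed.

Lemma bilin_post U V W W' (g : W -> W') (f : U -> V -> W) :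
  linear g -> bilin f -> bilin (fun x y => g (f x y)).
Proof.
by move=> lg [f1 f2]; split=> z c x y; [rewrite -lg -f1|rewrite -lg -f2].
Qed.

Lemma unbal_balanced U V W (f : U -> V -> W) :
  bilin f -> balanced (@unbal _) (@unbal _) f.
Proof. by []. Qed.

End LinearClosure.

Section Graded.
Variables (k : fieldType) (G : groupType).

(* Internal direct sum decomposition of V into the subspaces gr_homog g. *)
Record grading (V : lmodType k) := Grading {
  gr_homog :> G -> V -> Prop;
  gr_homog0 : forall g, gr_homog g 0;
  gr_homogP : forall g c x y,
    gr_homog g x -> gr_homog g y -> gr_homog g (c *: x + y);
  gr_span : forall v, exists s : seq (G * V),
    (forall p, p \in s -> gr_homog p.1 p.2) /\ v = \sum_(p <- s) p.2;
  gr_free : forall (s : seq G) (f : G -> V), uniq s ->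
    (forall g, gr_homog g (f g)) -> \sum_(g <- s) f g = 0 ->
    forall g, g \in s -> f g = 0
}.

Record gradedSpace := GradedSpace {
  gs_sort :> lmodType k;
  gs_grading : grading gs_sort
}.

Definition homog (V : gradedSpace) (g : G) (v : V) : Prop :=
  gs_grading V g v.

Section HomogeneousExtension.
Variable V : gradedSpace.

Lemma homog0 g : @homog V g 0. Proof. exact: gr_homog0. Qed.
Lemma homogP g c (x y : V) : homog g x -> homog g y -> homog g (c *: x + y).
Proof. exact: gr_homogP. Qed.
Lemma homogD g (x y : V) : homog g x -> homog g y -> homog g (x + y).
Proof. by move=> hx hy; rewrite -[x]scale1r; apply: homogP. Qed.
Lemma homogZ g c (x : V) : homog g x -> homog g (c *: x).
Proof. by move=> hx; rewrite -[c *: x]addr0; apply: homogP => //; apply: homog0. Qed.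
Lemma homog_sum g (J : Type) (r : seq J) (P : pred J) (F : J -> V) :
  (forall j, P j -> homog g (F j)) -> homog g (\sum_(j <- r | P j) F j).
Proof. by move=> H; apply: big_ind => //; [exact: homog0|exact: homogD]. Qed.

Definition hlist (s : seq (G * V)) : Prop :=
  forall p, p \in s -> homog p.1 p.2.

Lemma hlist_cat s t : hlist s -> hlist t -> hlist (s ++ t).
Proof. by move=> hs ht p; rewrite mem_cat => /orP[/hs|/ht]. Qed.

Definition hdec (v : V) : seq (G * V) :=
  projT1 (cid (gr_span (gs_grading V) v)).

Lemma hdec_homog v : hlist (hdec v).
Proof. by rewrite /hdec; case: cid => s []. Qed.

Lemma hdec_sum v : v = \sum_(p <- hdec v) p.2.
Proof. by rewrite /hdec; case: cid => s []. Qed.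

(* The linear extension to V of the maps F g given on the elements of
   degree g. *)
Definition hext (W : lmodType k) (F : G -> V -> W) (v : V) : W :=
  \sum_(p <- hdec v) F p.1 p.2.

Section Hext.
Variables (W : lmodType k) (F : G -> V -> W) (lF : forall g, linear (F g)).

Let hext0 s : hlist s -> \sum_(p <- s) p.2 = 0 -> \sum_(p <- s) F p.1 p.2 = 0.
Proof.
move=> hs s0; set u := undup (map fst s).
have E (U : lmodType k) (K : G * V -> U) :
    \sum_(p <- s) K p = \sum_(g <- u) \sum_(p <- s | p.1 == g) K p.
  rewrite (exchange_big_dep xpredT) //=; apply: eq_big_seq => p sp.
  rewrite (eq_bigl (pred1 p.1)); last by move=> g; rewrite /= eq_sym.
  rewrite -big_filter filter_pred1_uniq ?undup_uniq ?big_seq1 //.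
  by rewrite mem_undup; apply: map_f.
have Z g : g \in u -> \sum_(p <- s | p.1 == g) p.2 = 0.
  apply: (gr_free (f := fun g => \sum_(p <- s | p.1 == g) p.2)).
  - exact: undup_uniq.
  - move=> h; rewrite big_seq_cond; apply: homog_sum => p /andP[sp /eqP <-].
    exact: hs.
  - by rewrite -E.
rewrite E big1_seq // => g /= gu.
have [F0 FD _] := linE (lF g).
rewrite (eq_bigr (fun p => F g p.2)); last by move=> p /eqP <-.
by rewrite -(big_morph _ FD F0) Z.
Qed.

Lemma hext_sum s v : hlist s -> v = \sum_(p <- s) p.2 ->
  hext F v = \sum_(p <- s) F p.1 p.2.
Proof.
move=> hs Ev; apply/eqP; rewrite -subr_eq0 /hext; apply/eqP.
pose t := hdec v ++ [seq (p.1, - p.2) | p <- s].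
have N g x : F g (- x) = - F g x.
  by have [_ _ Z] := linE (lF g); rewrite -scaleN1r Z scaleN1r.
have := @hext0 t; rewrite /t !big_cat !big_map /=.
under [X in _ -> _ -> _ + X = _]eq_bigr do rewrite N.
rewrite !sumrN; apply; last by rewrite -hdec_sum -Ev subrr.
apply: hlist_cat; first exact: hdec_homog.
by move=> _ /mapP[p /hs hp ->]; rewrite -scaleN1r; apply: homogZ.
Qed.

Lemma hextE g v : homog g v -> hext F v = F g v.
Proof.
move=> hv; rewrite (@hext_sum [:: (g, v)]) ?big_seq1 //.
by move=> p; rewrite inE => /eqP ->.
Qed.

Lemma hext_linear : linear (hext F).
Proof.
move=> c x y.
rewrite (@hext_sum ([seq (p.1, c *: p.2) | p <- hdec x] ++ hdec y)).
- rewrite big_cat big_map /=; congr (_ + _); rewrite scaler_sumr.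
  by apply: eq_bigr => p _; have [_ _ Z] := linE (lF p.1); apply: Z.
- apply: hlist_cat; last exact: hdec_homog.
  by move=> _ /mapP[p /hdec_homog hp ->]; apply: homogZ.
- by rewrite big_cat big_map /= -scaler_sumr -!hdec_sum.
Qed.

End Hext.

Lemma homog_ind (P : V -> Prop) : P 0 ->
  (forall g v, homog g v -> P v) -> (forall x y, P x -> P y -> P (x + y)) ->
  forall v, P v.
Proof.
move=> P0 Ph PD v; rewrite (hdec_sum v) big_seq.
by apply: big_ind => // p /hdec_homog; apply: Ph.
Qed.

Lemma homog_disj g h (v : V) : homog g v -> homog h v -> g != h -> v = 0.
Proof.
move=> hg hh gh; pose f x := if x == g then v else if x == h then - v else 0.
have fg : f g = v by rewrite /f eqxx.
rewrite -fg; apply: (@gr_free _ (gs_grading V) [:: g; h]).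
- by rewrite /= inE gh.
- move=> x; rewrite /f; case: eqP => [->//|_]; case: eqP => [->|_]; last exact: homog0.
  by rewrite -scaleN1r; apply: homogZ.
- by rewrite !big_cons big_nil fg /f eqxx eq_sym (negPf gh) addr0 subrr.
- by rewrite inE eqxx.
Qed.

Definition hproj (g : G) : V -> V :=
  hext (fun (h : G) (v : V) => if h == g then v else 0).

Let hprojF (g h : G) : linear (fun v : V => if h == g then v else 0).
Proof. by move=> c x y; case: eqP; rewrite ?scaler0 ?addr0. Qed.

Lemma hproj_linear g : linear (hproj g).
Proof. exact/hext_linear/hprojF. Qed.

Lemma hprojE g h (v : V) : homog h v -> hproj g v = if h == g then v else 0.
Proof. by move=> hv; rewrite /hproj (hextE _ hv) //; apply: hprojF. Qed.

Lemma hproj_homog g (v : V) : homog g (hproj g v).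
Proof.
rewrite /hproj /hext big_seq; apply: homog_sum => p /hdec_homog hp.
by case: eqP => [<-|_] //; apply: homog0.
Qed.

End HomogeneousExtension.

Lemma gr_free_of_proj (V : lmodType k) (hm : G -> V -> Prop) (pr : G -> V -> V) :
  (forall g, linear (pr g)) ->
  (forall g h v, hm h v -> pr g v = if h == g then v else 0) ->
  forall (s : seq G) (f : G -> V), uniq s ->
    (forall g, hm g (f g)) -> \sum_(g <- s) f g = 0 ->
    forall g, g \in s -> f g = 0.
Proof.
move=> lpr prE s f us hf s0 g gs; have [p0 pD _] := linE (lpr g).
have := congr1 (pr g) s0; rewrite p0 (big_morph _ pD p0).
under eq_bigr => h _ do rewrite (prE g h) //.
by rewrite -big_mkcond -big_filter filter_pred1_uniq // big_seq1.
Qed.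

Record gmap (V W : gradedSpace) := GMap {
  gm_lin :> {linear V -> W};
  gm_homog : forall g v, homog g v -> homog g (gm_lin v)
}.

Lemma gmap_eq V W (f g : gmap V W) : f =1 g -> f = g.
Proof.
case: f g => f hf [g hg] /= /linear_eq E; case: _ / E in hg *.
by rewrite (Prop_irrelevance hf hg).
Qed.

Definition gid V : gmap V V := @GMap V V idfun (fun _ _ h => h).

Definition gcomp U V W (g : gmap V W) (f : gmap U V) : gmap U W :=
  @GMap U W (g \o f) (fun _ _ h => gm_homog g (gm_homog f h)).

Section BaseField.

Definition kk_homog (g : G) (c : k^o) : Prop := g != 1%g -> c = 0.

Let kk0 g : kk_homog g 0. Proof. by []. Qed.

Let kkP g c (x y : k^o) : kk_homog g x -> kk_homog g y -> kk_homog g (c *: x + y).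
Proof. by move=> hx hy g1; rewrite hx // hy // scaler0 addr0. Qed.

Let kk_span (v : k^o) : exists s : seq (G * k^o),
  (forall p, p \in s -> kk_homog p.1 p.2) /\ v = \sum_(p <- s) p.2.
Proof.
exists [:: (1%g, v)]; rewrite big_seq1; split=> // p.
by rewrite inE => /eqP -> /eqP.
Qed.

Let kk_free (s : seq G) (f : G -> k^o) : uniq s ->
  (forall g, kk_homog g (f g)) -> \sum_(g <- s) f g = 0 ->
  forall g, g \in s -> f g = 0.
Proof.
apply: (@gr_free_of_proj _ _ (fun g v => if g == 1%g then v else 0)).
  by move=> g c x y; case: eqP => _; rewrite ?scaler0 ?addr0.
move=> g h v; case: (eqVneq h g) => [->|hg] hv.
  by case: eqP => // /eqP g1; rewrite hv.
by case: eqP => // g1; apply: hv; rewrite -g1.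
Qed.

Definition kk : gradedSpace :=
  @GradedSpace k^o (@Grading k^o kk_homog kk0 kkP kk_span kk_free).

End BaseField.
End Graded.

Section GradedTensor.
Variables (k : fieldType) (G : groupType).

Lemma hproj_sum (V : gradedSpace k G) (v : V) :
  exists2 r : seq G, uniq r & v = \sum_(g <- r) hproj g v.
Proof.
exists (undup (map fst (hdec v))); first exact: undup_uniq.
rewrite {1}(hdec_sum v) /hproj /hext.
rewrite (exchange_big_dep xpredT) //=; apply: eq_big_seq => p sp.
rewrite -big_mkcond (eq_bigl (pred1 p.1)); last by move=> g; rewrite /= eq_sym.
rewrite -big_filter filter_pred1_uniq ?undup_uniq ?big_seq1 //.
by rewrite mem_undup; apply: map_f.
Qed.

Lemma hproj_comm (V W : gradedSpace k G) (f : V -> W) :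
  linear f -> (forall g v, homog g v -> homog g (f v)) ->
  forall g v, hproj g (f v) = f (hproj g v).
Proof.
move=> lf hf g v; have [f0 fD _] := linE lf.
have [p0 pD _] := linE (@hproj_linear _ _ V g).
have [q0 qD _] := linE (@hproj_linear _ _ W g).
elim/homog_ind: v => [|h v hv|x y Ex Ey].
- by rewrite f0 p0 q0 f0.
- by rewrite (hprojE _ hv) (hprojE _ (hf _ _ hv)); case: eqP; rewrite ?f0.
- by rewrite fD pD qD fD Ex Ey.
Qed.

Section Balanced.
Variables (M N : gradedSpace k G) (I : Type).
Variables (ra : I -> M -> M) (la : I -> N -> N).

Local Notation T := (btensor ra la).

Definition tens_homog (g : G) (t : T) : Prop :=
  exists s : seq (M * N),
    (forall p, p \in s -> exists g' g'',
      [/\ (g' * g'')%g = g, homog g' p.1 & homog g'' p.2]) /\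
    t = \sum_(p <- s) tens p.1 p.2.

Definition tens_comp (g : G) (m : M) (n : N) : T :=
  hext (fun h m' => tens m' (hproj (h^-1 * g)%g n)) m.

Lemma tens_comp_bilin g : bilin (tens_comp g).
Proof.
have [t1 t2] := tens_bilin ra la.
split=> [n|m].
  by apply: hext_linear => h; apply: t1.
apply: linear_sumf => p; apply: linear_comp; first exact: t2.
exact: hproj_linear.
Qed.

Lemma tens_compE g h h' (m : M) (n : N) : homog h m -> homog h' n ->
  tens_comp g m n = if (h * h')%g == g then tens m n else 0.
Proof.
move=> hm hn; have [t1 t2] := tens_bilin ra la.
rewrite /tens_comp (hextE _ hm) => [|x]; last exact: t1.
rewrite (hprojE _ hn).
have -> : (h' == h^-1 * g)%g = (h * h' == g)%g.
  by apply/eqP/eqP => [->|<-]; rewrite ?mulVKg ?mulKg.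
by case: eqP => // _; have [/= -> _ _] := linE (t2 m).
Qed.

Hypothesis comp_bal : forall g i m n,
  tens_comp g (ra i m) n = tens_comp g m (la i n).

Let th0 g : tens_homog g 0.
Proof. by exists [::]; rewrite big_nil. Qed.

Lemma tens_homog1 g h (m : M) (n : N) : homog g m -> homog h n ->
  tens_homog (g * h)%g (tens m n).
Proof.
move=> hm hn; exists [:: (m, n)]; rewrite big_seq1; split=> // p.
by rewrite inE => /eqP ->; exists g, h.
Qed.

Let thP g c (x y : T) :
  tens_homog g x -> tens_homog g y -> tens_homog g (c *: x + y).
Proof.
move=> [s [hs ->]] [t [ht ->]].
exists ([seq (c *: p.1, p.2) | p <- s] ++ t); split.
  move=> p; rewrite mem_cat => /orP[/mapP[q /hs [g' [g'' [e h1 h2]]] ->]|/ht //].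
  by exists g', g''; split=> //=; apply: homogZ.
rewrite big_cat big_map /= scaler_sumr; congr (_ + _); apply: eq_bigr => p _.
by have [_ _ Z] := linE ((tens_bilin ra la).1 p.2); rewrite -Z.
Qed.

Let th_span (t : T) : exists s : seq (G * T),
  (forall p, p \in s -> tens_homog p.1 p.2) /\ t = \sum_(p <- s) p.2.
Proof.
have [t1 t2] := tens_bilin ra la.
elim/tens_ind: t => [m n|x y [s [hs ->]] [t [ht ->]]]; last first.
  exists (s ++ t); rewrite big_cat; split=> // p.
  by rewrite mem_cat => /orP[/hs|/ht].
exists [seq ((p.1 * q.1)%g, tens p.2 q.2) | p <- hdec m, q <- hdec n]; split.
  move=> _ /allpairsP[[p q] /= [/hdec_homog hp /hdec_homog hq ->]].
  exact: tens_homog1.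
rewrite big_allpairs_dep {1}(hdec_sum m) /=.
have [z D _] := linE (t1 n); rewrite (big_morph _ D z); apply: eq_bigr => p _.
rewrite {1}(hdec_sum n).
by have [z' D' _] := linE (t2 p.2); rewrite (big_morph _ D' z').
Qed.

Let th_free (s : seq G) (f : G -> T) : uniq s ->
  (forall g, tens_homog g (f g)) -> \sum_(g <- s) f g = 0 ->
  forall g, g \in s -> f g = 0.
Proof.
have bal g : balanced ra la (tens_comp g).
  by split; [exact: tens_comp_bilin|exact: comp_bal].
apply: (@gr_free_of_proj _ _ _ _ (fun g => teval (tens_comp g))) => [g|].
  exact: teval_linear.
move=> g h v [r [hr ->]]; have [z D _] := linE (teval_linear (bal g)).
rewrite (big_morph _ D z).
rewrite (eq_big_seq (fun p => if h == g then tens p.1 p.2 else 0)).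
  by case: eqP => // _; rewrite big1.
move=> p /hr[g' [g'' [<- h1 h2]]].
by rewrite (tevalE (bal g)) (tens_compE _ h1 h2).
Qed.

Definition gbtens : gradedSpace k G :=
  @GradedSpace k G T (@Grading k G T tens_homog th0 thP th_span th_free).

Lemma tens_homogT g h (m : M) (n : N) : homog g m -> homog h n ->
  @homog _ _ gbtens (g * h)%g (tens m n).
Proof. exact: tens_homog1. Qed.

Lemma gbtens_homog_map (W : gradedSpace k G) (f : gbtens -> W) (c : G -> G) :
  linear f ->
  (forall g h m n, homog g m -> homog h n -> homog (c (g * h)%g) (f (tens m n))) ->
  forall g t, homog g t -> homog (c g) (f t).
Proof.
move=> /linE[f0 fD _] hf g _ [s [hs ->]].
rewrite (big_morph _ fD f0) big_seq; apply: homog_sum => p /hs.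
by move=> [g' [g'' [<- h1 h2]]]; apply: hf.
Qed.

End Balanced.

Lemma unbal_comp_bal (M N : gradedSpace k G) (g : G) (i : void) (m : M) (n : N) :
  tens_comp (@unbal _) (@unbal _) g (unbal i m) n =
  tens_comp (@unbal _) (@unbal _) g m (unbal i n).
Proof. by []. Qed.

Definition gtens (M N : gradedSpace k G) : gradedSpace k G :=
  gbtens (@unbal_comp_bal M N).

End GradedTensor.

Notation "M ⊠ N" := (gtens M N) (at level 40, left associativity).

Section TensorMaps.
Variables (k : fieldType) (G : groupType).
Implicit Types U V W M N : gradedSpace k G.

Definition tmap U V M N (f : U -> M) (g : V -> N) (t : U ⊠ V) : M ⊠ N :=
  teval (fun u v => f u ⊗ g v) t.

Definition tassoc U V W (t : (U ⊠ V) ⊠ W) : U ⊠ (V ⊠ W) :=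
  teval (fun (p : U ⊠ V) w => teval (fun u v => u ⊗ (v ⊗ w : V ⊠ W)) p) t.

Lemma gtens_bilin U V : bilin (fun (u : U) (v : V) => u ⊗ v : U ⊠ V).
Proof. exact: tens_bilin. Qed.

Lemma gtens_homog U V g h (u : U) (v : V) : homog g u -> homog h v ->
  homog (V := U ⊠ V) (g * h)%g (u ⊗ v).
Proof. exact: tens_homogT. Qed.

Lemma tmap_bilin U V M N (f : U -> M) (g : V -> N) :
  linear f -> linear g -> bilin (fun u v => f u ⊗ g v : M ⊠ N).
Proof. by move=> lf lg; exact: (bilin_comp (gtens_bilin M N) lf lg). Qed.

Lemma tmapE U V M N (f : U -> M) (g : V -> N) u v :
  linear f -> linear g -> tmap f g (u ⊗ v) = f u ⊗ g v.
Proof. by move=> lf lg; apply: tevalE; split=> //; apply: tmap_bilin. Qed.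

Lemma tmap_linear U V M N (f : U -> M) (g : V -> N) :
  linear f -> linear g -> linear (tmap f g).
Proof. by move=> lf lg; apply: teval_linear; split=> //; apply: tmap_bilin. Qed.

Lemma tassoc_bilin U V W :
  bilin (fun (p : U ⊠ V) (w : W) =>
    teval (fun u v => u ⊗ (v ⊗ w : V ⊠ W)) p : U ⊠ (V ⊠ W)).
Proof.
have [a1 a2] := gtens_bilin U (V ⊠ W).
have [b1 b2] := gtens_bilin V W.
split=> [w|p].
  apply: teval_linear; split=> //.
  by split=> [v|u]; [apply: a1|apply: linear_comp (b1 w)].
by apply: linear_sumf => q; apply: linear_comp (b2 _).
Qed.

Lemma tassocE U V W (u : U) (v : V) (w : W) :
  tassoc ((u ⊗ v : U ⊠ V) ⊗ w) = u ⊗ (v ⊗ w : V ⊠ W).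
Proof.
rewrite /tassoc tevalE; last by split=> //; apply: tassoc_bilin.
have [a1 a2] := gtens_bilin U (V ⊠ W).
have [b1 b2] := gtens_bilin V W.
rewrite tevalE //; split=> //.
by split=> [v'|u']; [apply: a1|apply: linear_comp (b1 w)].
Qed.

Lemma tassoc_linear U V W : linear (@tassoc U V W).
Proof. by apply: teval_linear; split=> //; apply: tassoc_bilin. Qed.

End TensorMaps.

Section Algebras.
Variables (k : fieldType) (G : groupType).

Record bicharacter := Bicharacter {
  bichar :> G -> G -> k;
  bichar_neq0 : forall g h, bichar g h != 0;
  bicharMr : forall g h h', bichar g (h * h')%g = bichar g h * bichar g h';
  bicharMl : forall g g' h, bichar (g * g')%g h = bichar g h * bichar g' h
}.

Lemma bichar1r (chi : bicharacter) g : chi g 1%g = 1.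
Proof.
apply: (mulIf (bichar_neq0 chi g 1%g)).
by rewrite -bicharMr mul1g mul1r.
Qed.

(* Not based on algType, whose instances are nonzero rings. *)
Record alg_on (V : gradedSpace k G) := AlgOn {
  alg_mul : V -> V -> V;
  alg_one : V;
  alg_mul_bilin : bilin alg_mul;
  alg_mulA : associative alg_mul;
  alg_mul1l : left_id alg_one alg_mul;
  alg_mul1r : right_id alg_one alg_mul;
  alg_one_homog : homog 1%g alg_one;
  alg_mul_homog : forall g h x y,
    homog g x -> homog h y -> homog (g * h)%g (alg_mul x y)
}.

Record colourAlg := ColourAlg {
  ca_space :> gradedSpace k G;
  ca_alg : alg_on ca_space
}.

Definition cmul (A : colourAlg) : A -> A -> A := alg_mul (ca_alg A).
Definition cone (A : colourAlg) : A := alg_one (ca_alg A).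

Definition is_alg_map (A B : colourAlg) (f : A -> B) : Prop :=
  f (cone A) = cone B /\ forall x y, f (cmul x y) = cmul (f x) (f y).

Record mod_on (R : colourAlg) (V : gradedSpace k G) := ModOn {
  mod_act : R -> V -> V;
  mod_act_bilin : bilin mod_act;
  mod_actA : forall r s v, mod_act (cmul r s) v = mod_act r (mod_act s v);
  mod_act1 : forall v, mod_act (cone R) v = v;
  mod_act_homog : forall g h r v,
    homog g r -> homog h v -> homog (g * h)%g (mod_act r v)
}.

Record gmod (R : colourAlg) := GMod {
  md_space :> gradedSpace k G;
  md_mod : mod_on R md_space
}.

Definition act (R : colourAlg) (M : gmod R) : R -> M -> M := mod_act (md_mod M).

(* The linear extension of
     (x ⊗ a) (y ⊗ m) = (|a| / |y|) x y ⊗ op a m,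
   the colour product on H ⊗ A if op is the product of A and the colour
   action of H ⊗ A on H ⊗ M if op is the action of A on M. *)
Definition colour_act (chi : bicharacter) (H : colourAlg)
    (A M N : gradedSpace k G) (op : A -> M -> N) (t : H ⊠ A) (u : H ⊠ M) :
    H ⊠ N :=
  teval (fun x a => teval (fun y m =>
    hext (fun g a' => hext (fun h y' =>
      chi g h *: (cmul x y' ⊗ op a' m : H ⊠ N)) y) a) u) t.

Section ColourAct.
Variables (chi : bicharacter) (H : colourAlg).
Variables (A M N : gradedSpace k G) (op : A -> M -> N) (bop : bilin op).

Let F (x y : H) (a : A) (m : M) (g h : G) : H ⊠ N :=
  chi g h *: (cmul x y ⊗ op a m : H ⊠ N).

Let Fx y a m g h : linear (fun x => F x y a m g h).
Proof.
have l := (alg_mul_bilin (ca_alg H)).1 y.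
exact: linear_scalef (linear_comp ((gtens_bilin H N).1 (op a m)) l).
Qed.
Let Fy x a m g h : linear (fun y => F x y a m g h).
Proof.
have l := (alg_mul_bilin (ca_alg H)).2 x.
exact: linear_scalef (linear_comp ((gtens_bilin H N).1 (op a m)) l).
Qed.
Let Fa x y m g h : linear (fun a => F x y a m g h).
Proof.
exact: linear_scalef (linear_comp ((gtens_bilin H N).2 (cmul x y)) (bop.1 m)).
Qed.
Let Fm x y a g h : linear (fun m => F x y a m g h).
Proof.
exact: linear_scalef (linear_comp ((gtens_bilin H N).2 (cmul x y)) (bop.2 a)).
Qed.

Let K (x : H) (a : A) (y : H) (m : M) : H ⊠ N :=
  hext (fun g a' => hext (fun h y' => F x y' a' m g h) y) a.

Let Kx a y m : linear (fun x => K x a y m).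
Proof. by do 2![apply: linear_sumf => ?]; apply: Fx. Qed.
Let Km x a y : linear (fun m => K x a y m).
Proof. by do 2![apply: linear_sumf => ?]; apply: Fm. Qed.
Let Ky x a m : linear (fun y => K x a y m).
Proof. by apply: linear_sumf => ?; apply: hext_linear => h; apply: Fy. Qed.
Let Ka x y m : linear (fun a => K x a y m).
Proof. by apply: hext_linear => g; apply: linear_sumf => q; apply: Fa. Qed.

Lemma colour_act_bilin : bilin (colour_act chi op : H ⊠ A -> H ⊠ M -> H ⊠ N).
Proof.
split=> [u|t].
  apply: teval_linear; split=> //.
  by split=> [a|x]; apply: linear_sumf => q; [apply: Kx|apply: Ka].
by apply: linear_sumf => p; apply: teval_linear; split=> //; split=> *;
  [apply: Ky|apply: Km].
Qed.

Lemma colour_actE x a y m g h : homog g a -> homog h y ->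
  colour_act chi op (x ⊗ a : H ⊠ A) (y ⊗ m : H ⊠ M) =
  chi g h *: (cmul x y ⊗ op a m : H ⊠ N).
Proof.
move=> ha hy; rewrite /colour_act tevalE; last first.
  split=> //.
  by split=> [a'|x']; apply: linear_sumf => q; [apply: Kx|apply: Ka].
rewrite tevalE; last by split=> //; split=> *; [apply: Ky|apply: Km].
rewrite (hextE _ ha) => [|g']; last by apply: linear_sumf => q; apply: Fa.
by rewrite (hextE _ hy) // => h'; apply: Fy.
Qed.

Lemma colour_actE1 x a y m : homog 1%g y ->
  colour_act chi op (x ⊗ a : H ⊠ A) (y ⊗ m : H ⊠ M) =
  (cmul x y ⊗ op a m : H ⊠ N).
Proof.
move=> hy; have [cl _] := colour_act_bilin; have [t1 t2] := gtens_bilin H A.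
have [s1 s2] := gtens_bilin H N.
have l1 := linear_comp (cl (y ⊗ m)) (t2 x).
have l2 := linear_comp (s2 (cmul x y)) (bop.1 m).
have [z1 D1 _] := linE l1; have [z2 D2 _] := linE l2.
elim/homog_ind: a => [|g a ha|a b Ea Eb].
- by rewrite z1 z2.
- by rewrite (colour_actE _ _ ha hy) bichar1r scale1r.
- by rewrite D1 D2 Ea Eb.
Qed.

End ColourAct.

End Algebras.

Notation "x ⋅ y" := (cmul x y) (at level 40, left associativity) : ring_scope.
Notation "r • m" := (act r m) (at level 40, left associativity) : ring_scope.

Section Hopf.
Variables (k : fieldType) (G : groupType) (chi : bicharacter k G).

(* A Sweedler sum over Δ(h) = h_1 ⊗ h_2 is written
   teval (fun h1 h2 => _) (comul h). *)
Record colourHopf := ColourHopf {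
  ch_alg :> colourAlg k G;
  comul : gmap ch_alg (ch_alg ⊠ ch_alg);
  counit : gmap ch_alg (kk k G);
  comulA : forall h, tmap idfun comul (comul h) =
    tassoc (tmap comul idfun (comul h));
  counitl : forall h, teval (fun h1 h2 => (counit h1 : k) *: h2) (comul h) = h;
  counitr : forall h, teval (fun h1 h2 => (counit h2 : k) *: h1) (comul h) = h;
  counit1 : counit (cone ch_alg) = 1 :> k;
  counitM : forall h h',
    counit (h ⋅ h') = (counit h : k) * (counit h' : k) :> k;
  comul1 : comul (cone ch_alg) = cone ch_alg ⊗ cone ch_alg;
  comulM : forall h h', comul (h ⋅ h') =
    colour_act chi (@cmul k G ch_alg) (comul h) (comul h');
  antipode : gmap ch_alg ch_alg;
  antipoder : forall h, teval (fun h1 h2 => h1 ⋅ antipode h2) (comul h) =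
    (counit h : k) *: cone ch_alg;
  antipodel : forall h, teval (fun h1 h2 => antipode h1 ⋅ h2) (comul h) =
    (counit h : k) *: cone ch_alg
}.

Record comod_on (H : colourHopf) (V : gradedSpace k G) := ComodOn {
  cm_coact : gmap V (H ⊠ V);
  cm_coactA : forall v, tmap idfun cm_coact (cm_coact v) =
    tassoc (tmap (comul H) idfun (cm_coact v));
  cm_counit : forall v,
    teval (fun h w => (counit H h : k) *: w) (cm_coact v) = v
}.

Record gcomod (H : colourHopf) := GComod {
  cm_space :> gradedSpace k G;
  cm_comod : comod_on H cm_space
}.

Definition coact (H : colourHopf) (M : gcomod H) : gmap M (H ⊠ M) :=
  cm_coact (cm_comod M).

Definition Hcomod (H : colourHopf) : gcomod H :=
  GComod (@ComodOn H H (comul H) (@comulA H) (@counitl H)).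

Definition colinear (H : colourHopf) (M N : gcomod H) (f : M -> N) : Prop :=
  forall m, coact N (f m) = tmap idfun f (coact M m).

Record comodAlg (H : colourHopf) := ComodAlg {
  cA_space :> gradedSpace k G;
  cA_alg_on : alg_on cA_space;
  cA_comod_on : comod_on H cA_space;
  cA_coact1 : cm_coact cA_comod_on (alg_one cA_alg_on) =
    cone H ⊗ alg_one cA_alg_on;
  cA_coactM : forall a a', cm_coact cA_comod_on (alg_mul cA_alg_on a a') =
    colour_act chi (alg_mul cA_alg_on)
      (cm_coact cA_comod_on a) (cm_coact cA_comod_on a')
}.

Definition cA_alg (H : colourHopf) (A : comodAlg H) : colourAlg k G :=
  ColourAlg (cA_alg_on A).
Definition cA_comod (H : colourHopf) (A : comodAlg H) : gcomod H :=
  GComod (cA_comod_on A).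

Record hopfMod (H : colourHopf) (A : comodAlg H) := HopfMod {
  hm_space :> gradedSpace k G;
  hm_mod_on : mod_on (cA_alg A) hm_space;
  hm_comod_on : comod_on H hm_space;
  hm_coactM : forall a m, cm_coact hm_comod_on (mod_act hm_mod_on a m) =
    colour_act chi (mod_act hm_mod_on)
      (cm_coact (cA_comod_on A) a) (cm_coact hm_comod_on m)
}.

Definition hm_mod (H : colourHopf) (A : comodAlg H) (M : hopfMod A) :
  gmod (cA_alg A) := GMod (hm_mod_on M).
Definition hm_comod (H : colourHopf) (A : comodAlg H) (M : hopfMod A) :
  gcomod H := GComod (hm_comod_on M).

Section Coinvariants.
Variables (H : colourHopf) (M : gcomod H).

Definition coinv_pred : {pred M} :=
  fun m => `[< coact M m = cone H ⊗ m >].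

Lemma coinvP m : reflect (coact M m = cone H ⊗ m) (m \in coinv_pred).
Proof. exact: asboolP. Qed.

Lemma coinv_submod_closed : GRing.submod_closed coinv_pred.
Proof.
have [z D _] := linE ((gtens_bilin H M).2 (cone H)).
split=> [|c x y /coinvP Ex /coinvP Ey]; apply/coinvP.
  by rewrite linear0 z.
rewrite linearP Ex Ey; exact/esym/((gtens_bilin H M).2 (cone H)).
Qed.
HB.instance Definition _ :=
  GRing.isSubmodClosed.Build k M coinv_pred coinv_submod_closed.

Record coinvT := Coinv {
  coinv_val :> M;
  coinv_valP : coinv_val \in coinv_pred
}.

HB.instance Definition _ := [isSub for coinv_val].
HB.instance Definition _ := [Choice of coinvT by <:].
HB.instance Definition _ := [SubChoice_isSubLmodule of coinvT by <:].

Definition coinv_homog (g : G) (x : coinvT) : Prop := homog g (coinv_val x).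

Lemma coinv_proj (m : M) g : m \in coinv_pred -> hproj g m \in coinv_pred.
Proof.
move=> /coinvP E; apply/coinvP.
have lc : linear (coact M) by exact: linearP.
rewrite -(hproj_comm lc (gm_homog (coact M))) E.
have := @hproj_comm _ _ M (H ⊠ M) (fun m => cone H ⊗ m)
  ((gtens_bilin H M).2 (cone H)).
apply=> h v hv; rewrite -[h]mul1g; apply: gtens_homog => //.
exact: alg_one_homog.
Qed.

Let ch0 g : coinv_homog g 0. Proof. exact: homog0. Qed.
Let chP g c (x y : coinvT) :
  coinv_homog g x -> coinv_homog g y -> coinv_homog g (c *: x + y).
Proof. exact: homogP. Qed.
Let coinv_val0 : coinv_val 0 = 0. Proof. by []. Qed.
Let coinv_valD : {morph coinv_val : x y / x + y}. Proof. by []. Qed.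

Let ch_span (v : coinvT) : exists s : seq (G * coinvT),
  (forall p, p \in s -> coinv_homog p.1 p.2) /\ v = \sum_(p <- s) p.2.
Proof.
have [r _ Er] := hproj_sum (coinv_val v).
exists [seq (g, Coinv (coinv_proj g (coinv_valP v))) | g <- r]; split.
  by move=> _ /mapP[g _ ->]; apply: hproj_homog.
apply: val_inj; rewrite /= {1}Er big_map.
by rewrite (big_morph _ coinv_valD coinv_val0).
Qed.

Let ch_free (s : seq G) (f : G -> coinvT) : uniq s ->
  (forall g, coinv_homog g (f g)) -> \sum_(g <- s) f g = 0 ->
  forall g, g \in s -> f g = 0.
Proof.
move=> us hf s0 g gs; apply: val_inj => /=.
apply: (@gr_free _ _ _ (gs_grading M) s (fun g => coinv_val (f g))) => //.
by rewrite -(big_morph _ coinv_valD coinv_val0) s0.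
Qed.

Definition coinv : gradedSpace k G :=
  @GradedSpace k G coinvT (@Grading k G coinvT coinv_homog ch0 chP ch_span ch_free).

End Coinvariants.

Arguments coinv_pred {H} M.

Section CoinvariantAlgebra.
Variables (H : colourHopf) (A : comodAlg H).

Lemma colour_act_coinv (M : gradedSpace k G) (op : A -> M -> M) (a : A) (m : M) :
  bilin op ->
  colour_act chi op (cone H ⊗ a : H ⊠ A) (cone H ⊗ m : H ⊠ M) =
  (cone H ⊗ op a m : H ⊠ M).
Proof.
move=> bop; rewrite colour_actE1 //; last exact: alg_one_homog.
by congr (tens _ _); apply: alg_mul1l.
Qed.

Lemma coinvM (a b : cA_alg A) : a \in coinv_pred (cA_comod A) ->
  b \in coinv_pred (cA_comod A) -> a ⋅ b \in coinv_pred (cA_comod A).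
Proof.
move=> /coinvP Ea /coinvP Eb; apply/coinvP.
rewrite /coact /= cA_coactM; move: Ea Eb; rewrite /coact /= => -> ->.
by rewrite colour_act_coinv //; apply: alg_mul_bilin.
Qed.

Lemma coinv1 : cone (cA_alg A) \in coinv_pred (cA_comod A).
Proof. exact/coinvP/cA_coact1. Qed.

Local Notation B := (coinv (cA_comod A)).

Definition coinv_mul (a b : B) : B :=
  Coinv (coinvM (coinv_valP a) (coinv_valP b)).
Definition coinv_one : B := Coinv coinv1.

Lemma coinv_mul_bilin : bilin coinv_mul.
Proof.
have [m1 m2] := alg_mul_bilin (cA_alg_on A).
by split=> x c y z; apply: val_inj; [apply: m1|apply: m2].
Qed.

Let coinv_mulA : associative coinv_mul.
Proof. by move=> a b c; apply: val_inj; apply: (alg_mulA (cA_alg_on A)). Qed.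
Let coinv_mul1l : left_id coinv_one coinv_mul.
Proof. by move=> a; apply: val_inj; apply: (alg_mul1l (cA_alg_on A)). Qed.
Let coinv_mul1r : right_id coinv_one coinv_mul.
Proof. by move=> a; apply: val_inj; apply: (alg_mul1r (cA_alg_on A)). Qed.
Let coinv_one_homog : homog 1%g coinv_one.
Proof. exact: (alg_one_homog (cA_alg_on A)). Qed.
Let coinv_mul_homog g h (x y : B) :
  homog g x -> homog h y -> homog (g * h)%g (coinv_mul x y).
Proof. exact: (alg_mul_homog (cA_alg_on A)). Qed.

Definition coinvAlg : colourAlg k G :=
  ColourAlg (AlgOn coinv_mul_bilin coinv_mulA coinv_mul1l coinv_mul1r
    coinv_one_homog coinv_mul_homog).

Section CoinvariantModule.
Variable M : hopfMod A.

Lemma coinv_actP (b : coinvAlg) (m : coinv (hm_comod M)) :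
  mod_act (hm_mod_on M) (coinv_val b) (coinv_val m) \in coinv_pred (hm_comod M).
Proof.
have /coinvP := coinv_valP b; have /coinvP := coinv_valP m.
rewrite /coact /= => Em Eb; apply/coinvP; rewrite /coact /= hm_coactM Em Eb.
by rewrite colour_act_coinv //; exact: (mod_act_bilin (hm_mod_on M)).
Qed.

Definition coinv_act (b : coinvAlg) (m : coinv (hm_comod M)) :
  coinv (hm_comod M) := Coinv (coinv_actP b m).

Let coinv_act_bilin : bilin coinv_act.
Proof.
have [m1 m2] := mod_act_bilin (hm_mod_on M).
by split=> x c y z; apply: val_inj; [apply: m1|apply: m2].
Qed.
Let coinv_actA r s v : coinv_act (r ⋅ s) v = coinv_act r (coinv_act s v).
Proof. by apply: val_inj; apply: (mod_actA (hm_mod_on M)). Qed.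
Let coinv_act1 v : coinv_act (cone coinvAlg) v = v.
Proof. by apply: val_inj; apply: (mod_act1 (hm_mod_on M)). Qed.
Let coinv_act_homog g h (r : coinvAlg) (v : coinv (hm_comod M)) :
  homog g r -> homog h v -> homog (g * h)%g (coinv_act r v).
Proof. exact: (mod_act_homog (hm_mod_on M)). Qed.

Definition coinvMod : gmod coinvAlg :=
  GMod (ModOn coinv_act_bilin coinv_actA coinv_act1 coinv_act_homog).

End CoinvariantModule.
End CoinvariantAlgebra.
End Hopf.

Arguments coinv_pred {k G chi H} M.

Record category := Category {
  ob :> Type;
  hom : ob -> ob -> Type;
  idm : forall X, hom X X;
  compm : forall X Y Z, hom Y Z -> hom X Y -> hom X Z;
  compm1l : forall X Y (f : hom X Y), compm (idm Y) f = f;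
  compm1r : forall X Y (f : hom X Y), compm f (idm X) = f;
  compmA : forall X Y Z T (h : hom Z T) (g : hom Y Z) (f : hom X Y),
    compm h (compm g f) = compm (compm h g) f
}.

Arguments idm {c} X.
Arguments compm {c X Y Z} g f.

Record functor (C D : category) := Functor {
  fob :> C -> D;
  fhom : forall X Y : C, hom X Y -> hom (fob X) (fob Y);
  fhom1 : forall X : C, fhom (idm X) = idm (fob X);
  fhomM : forall (X Y Z : C) (g : hom Y Z) (f : hom X Y),
    fhom (compm g f) = compm (fhom g) (fhom f)
}.

Arguments fhom {C D} _ {X Y} _.

Definition rel_injective (C D : category) (F : functor C D) (I : C) : Prop :=
  forall (X Y : C) (i : hom X Y),
    (exists r : hom (F Y) (F X), compm r (fhom F i) = idm (F X)) ->
    forall f : hom X I, exists g : hom Y I, compm g i = f.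

Definition rel_projective (C D : category) (F : functor D C) (P : D) : Prop :=
  forall (X Y : D) (p : hom X Y),
    (exists s : hom (F Y) (F X), compm (fhom F p) s = idm (F Y)) ->
    forall f : hom P Y, exists g : hom P X, compm p g = f.

Definition Maschke (C D : category) (F : functor C D) : Prop :=
  forall I : C, rel_injective F I.

Definition dual_Maschke (C D : category) (F : functor D C) : Prop :=
  forall P : D, rel_projective F P.

Section ModuleCategories.
Variables (k : fieldType) (G : groupType) (chi : bicharacter k G).

Section GradedModules.
Variable R : colourAlg k G.

Record gmodHom (M N : gmod R) := GModHom {
  gmh_map :> gmap M N;
  gmh_act : forall r m, gmh_map (r • m) = r • gmh_map m
}.

Lemma gmodHom_eq (M N : gmod R) (f g : gmodHom M N) : f =1 g -> f = g.
Proof.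
case: f g => f hf [g hg] /= /gmap_eq E; case: _ / E in hg *.
by rewrite (Prop_irrelevance hf hg).
Qed.

Definition gmodHom_id (M : gmod R) : gmodHom M M :=
  @GModHom M M (gid M) (fun _ _ => erefl).

Lemma gmodHom_comp_act (M N P : gmod R) (g : gmodHom N P) (f : gmodHom M N) r m :
  gcomp g f (r • m) = r • gcomp g f m.
Proof. by rewrite /= !gmh_act. Qed.

Definition gmodHom_comp (M N P : gmod R) (g : gmodHom N P) (f : gmodHom M N) :
  gmodHom M P := GModHom (gmodHom_comp_act g f).

Lemma gmodHom_comp1l (M N : gmod R) (f : gmodHom M N) :
  gmodHom_comp (gmodHom_id N) f = f.
Proof. exact: gmodHom_eq. Qed.

Lemma gmodHom_comp1r (M N : gmod R) (f : gmodHom M N) :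
  gmodHom_comp f (gmodHom_id M) = f.
Proof. exact: gmodHom_eq. Qed.

Lemma gmodHom_compA (M N P Q : gmod R) (h : gmodHom P Q) (g : gmodHom N P)
    (f : gmodHom M N) :
  gmodHom_comp h (gmodHom_comp g f) = gmodHom_comp (gmodHom_comp h g) f.
Proof. exact: gmodHom_eq. Qed.

Definition gmodCat : category :=
  Category gmodHom_comp1l gmodHom_comp1r gmodHom_compA.

End GradedModules.

Section HopfModules.
Variables (H : colourHopf chi) (A : comodAlg H).

Record hopfHom (M N : hopfMod A) := HopfHom {
  hh_map :> gmap M N;
  hh_act : forall (a : cA_alg A) (m : hm_mod M),
    hh_map (a • m) = a • (hh_map m : hm_mod N);
  hh_colinear : colinear (M := hm_comod M) (N := hm_comod N) hh_map
}.

Lemma hopfHom_eq (M N : hopfMod A) (f g : hopfHom M N) : f =1 g -> f = g.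
Proof.
case: f g => f hf cf [g hg cg] /= /gmap_eq E; case: _ / E in hg cg *.
by rewrite (Prop_irrelevance hf hg) (Prop_irrelevance cf cg).
Qed.

Lemma tmap_id (U V : gradedSpace k G) (t : U ⊠ V) : tmap idfun idfun t = t.
Proof. by rewrite [RHS]tens_sum. Qed.

Lemma tmap_comp (U U' U'' V V' V'' : gradedSpace k G)
    (f' : {linear U' -> U''}) (f : {linear U -> U'})
    (g' : {linear V' -> V''}) (g : {linear V -> V'}) (t : U ⊠ V) :
  tmap f' g' (tmap f g t) = tmap (f' \o f) (g' \o g) t.
Proof.
have [[lf' lf] [lg' lg]] := ((linearP f', linearP f), (linearP g', linearP g)).
have lff : linear (f' \o f) by exact: linear_comp lf.
have lgg : linear (g' \o g) by exact: linear_comp lg.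
apply: (tens_ext (f := fun t => tmap f' g' (tmap f g t))).
- by apply: linear_comp; apply: tmap_linear.
- exact: tmap_linear.
- by move=> u v /=; rewrite !tmapE.
Qed.

Definition hopfHom_id (M : hopfMod A) : hopfHom M M :=
  @HopfHom M M (gid M) (fun _ _ => erefl) (fun m => esym (tmap_id _)).

Lemma hopfHom_comp_act (M N P : hopfMod A) (g : hopfHom N P) (f : hopfHom M N)
    (a : cA_alg A) (m : hm_mod M) :
  gcomp g f (a • m) = a • (gcomp g f m : hm_mod P).
Proof. by rewrite /= !hh_act. Qed.

Lemma hopfHom_comp_colinear (M N P : hopfMod A) (g : hopfHom N P)
    (f : hopfHom M N) :
  colinear (M := hm_comod M) (N := hm_comod P) (gcomp g f).
Proof.
move=> m; rewrite /= (hh_colinear g) (hh_colinear f).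
exact: (tmap_comp idfun idfun g f).
Qed.

Definition hopfHom_comp (M N P : hopfMod A) (g : hopfHom N P)
    (f : hopfHom M N) : hopfHom M P :=
  HopfHom (hopfHom_comp_act g f) (hopfHom_comp_colinear g f).

Lemma hopfHom_comp1l (M N : hopfMod A) (f : hopfHom M N) :
  hopfHom_comp (hopfHom_id N) f = f.
Proof. exact: hopfHom_eq. Qed.

Lemma hopfHom_comp1r (M N : hopfMod A) (f : hopfHom M N) :
  hopfHom_comp f (hopfHom_id M) = f.
Proof. exact: hopfHom_eq. Qed.

Lemma hopfHom_compA (M N P Q : hopfMod A) (h : hopfHom P Q) (g : hopfHom N P)
    (f : hopfHom M N) :
  hopfHom_comp h (hopfHom_comp g f) = hopfHom_comp (hopfHom_comp h g) f.
Proof. exact: hopfHom_eq. Qed.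

Definition hopfCat : category :=
  Category hopfHom_comp1l hopfHom_comp1r hopfHom_compA.

Section CoinvariantsMap.
Variables (M N : hopfMod A) (f : hopfHom M N).

Lemma coinv_mapP (m : coinv (hm_comod M)) :
  f (coinv_val m) \in coinv_pred (hm_comod N).
Proof.
apply/coinvP; rewrite (hh_colinear f) (coinvP _ (coinv_valP m)).
by rewrite tmapE //; exact: linearP.
Qed.

Definition coinv_map (m : coinv (hm_comod M)) : coinv (hm_comod N) :=
  Coinv (coinv_mapP m).

Lemma coinv_map_linear : linear coinv_map.
Proof. by move=> c x y; apply: val_inj; rewrite /= linearP. Qed.

Lemma coinv_map_homog g (m : coinv (hm_comod M)) :
  homog g m -> homog g (linear_of coinv_map_linear m).
Proof. exact: (gm_homog f). Qed.

Lemma coinv_map_act (b : coinvAlg A) (m : coinvMod M) :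
  GMap coinv_map_homog (b • m) =
  b • (GMap coinv_map_homog m : coinvMod N).
Proof. by apply: val_inj; apply: (hh_act f). Qed.

Definition coinv_hom : gmodHom (coinvMod M) (coinvMod N) :=
  @GModHom _ (coinvMod M) (coinvMod N) (GMap coinv_map_homog) coinv_map_act.

End CoinvariantsMap.

Lemma coinv_hom1 (M : hopfMod A) :
  coinv_hom (hopfHom_id M) = gmodHom_id (coinvMod M).
Proof. by apply: gmodHom_eq => m; apply: val_inj. Qed.

Lemma coinv_homM (M N P : hopfMod A) (g : hopfHom N P) (f : hopfHom M N) :
  coinv_hom (hopfHom_comp g f) = gmodHom_comp (coinv_hom g) (coinv_hom f).
Proof. by apply: gmodHom_eq => m; apply: val_inj. Qed.

Definition coinvFunctor : functor hopfCat (gmodCat (coinvAlg A)) :=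
  @Functor hopfCat (gmodCat (coinvAlg A))
    (@coinvMod k G chi H A) coinv_hom coinv_hom1 coinv_homM.

Local Notation B := (coinvAlg A).

Section Induced.
Variable N : gmod B.

Definition ind_ra (b : B) (a : A) : A := @cmul k G (cA_alg A) a (coinv_val b).
Definition ind_la (b : B) (n : N) : N := b • n.

Lemma ind_comp_bal g (b : B) (a : A) (n : N) :
  tens_comp ind_ra ind_la g (ind_ra b a) n =
  tens_comp ind_ra ind_la g a (ind_la b n).
Proof.
have [c1 c2] := tens_comp_bilin ind_ra ind_la g.
have [m1 m2] := alg_mul_bilin (cA_alg_on A).
have [a1 a2] := mod_act_bilin (md_mod N).
have e (D : lmodType k) (f1 f2 : D -> btensor ind_ra ind_la) :
    linear f1 -> linear f2 ->
    (f1 0 = f2 0) * (forall x y, f1 x = f2 x -> f1 y = f2 y ->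
      f1 (x + y) = f2 (x + y)).
  move=> /linE[z1 D1 _] /linE[z2 D2 _]; split; first by rewrite z1 z2.
  by move=> x y Ex Ey; rewrite D1 D2 Ex Ey.
have [Z S] := e _ _ _ (linear_comp (c1 n) (m1 (coinv_val b))) (c1 (ind_la b n)).
elim/homog_ind: a => [||x y Ex Ey]; [exact: Z| |exact: S].
move=> ga a ha {Z S}.
have [Z S] := e _ _ _ (c2 (ind_ra b a)) (linear_comp (c2 a) (a2 b)).
elim/homog_ind: n => [||x y Ex Ey]; [exact: Z| |exact: S].
move=> gn n hn {Z S}.
have lv : linear (fun b : B => coinv_val b : A) by [].
have [Z S] := e _ _ _ (linear_comp (c1 n) (linear_comp (m2 a) lv))
  (linear_comp (c2 a) (a1 n)).
elim/homog_ind: b => [||x y Ex Ey]; [exact: Z| |exact: S].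
move=> gb b hb {Z S}.
have hab : homog (ga * gb)%g (ind_ra b a) by exact: alg_mul_homog.
have hbn : homog (gb * gn)%g (ind_la b n) by exact: mod_act_homog.
by rewrite (tens_compE _ _ _ hab hn) (tens_compE _ _ _ ha hbn) mulgA tens_bal.
Qed.

Definition ind : gradedSpace k G := gbtens ind_comp_bal.

Definition tensB (a : A) (n : N) : ind := tens a n.

Lemma tensB_bilin : bilin tensB.
Proof. exact: tens_bilin. Qed.

Lemma tensB_bal b a n : tensB (ind_ra b a) n = tensB a (b • n).
Proof. exact: tens_bal. Qed.

Lemma tensB_homog g h a n : homog g a -> homog h n ->
  homog (g * h)%g (tensB a n).
Proof. exact: tens_homogT. Qed.

Definition ind_act (a : cA_alg A) (t : ind) : ind :=
  teval (fun a' n => tensB (@cmul k G (cA_alg A) a a') n) t.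

Let ind_act_bal a : balanced ind_ra ind_la
  (fun a' n => tensB (@cmul k G (cA_alg A) a a') n).
Proof.
split.
  have [m1 m2] := alg_mul_bilin (cA_alg_on A).
  by split=> z; [apply: linear_comp (tensB_bilin.1 z) (m2 a)|
                 apply: tensB_bilin.2].
move=> b a' n; rewrite -tensB_bal /ind_ra; congr tensB.
exact: (alg_mulA (cA_alg_on A)).
Qed.

Lemma ind_actE a a' n :
  ind_act a (tensB a' n) = tensB (@cmul k G (cA_alg A) a a') n.
Proof. exact/tevalE/ind_act_bal. Qed.

Lemma ind_act_bilin : bilin ind_act.
Proof.
have [m1 m2] := alg_mul_bilin (cA_alg_on A).
split=> [t|a]; last exact/teval_linear/ind_act_bal.
by apply: linear_sumf => p; apply: linear_comp (tensB_bilin.1 p.2) (m1 p.1).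
Qed.

Let ind_actA r s v :
  ind_act (@cmul k G (cA_alg A) r s) v = ind_act r (ind_act s v).
Proof.
move: v; apply: tens_ext; [exact: ind_act_bilin.2| |].
  by apply: linear_comp; apply: ind_act_bilin.2.
move=> a n; rewrite !ind_actE; congr tensB.
exact/esym/(alg_mulA (cA_alg_on A)).
Qed.

Let ind_act1 v : ind_act (cone (cA_alg A)) v = v.
Proof.
move: v; apply: tens_ext; [exact: ind_act_bilin.2|by []|].
by move=> a n; rewrite ind_actE; congr tensB; apply: (alg_mul1l (cA_alg_on A)).
Qed.

Let ind_act_homog g h (a : cA_alg A) (t : ind) :
  homog g a -> homog h t -> homog (g * h)%g (ind_act a t).
Proof.
move=> ha; apply: (gbtens_homog_map (c := fun h => (g * h)%g)).
  exact: ind_act_bilin.2.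
move=> g' h' a' n ha' hn; rewrite ind_actE mulgA.
by apply: tensB_homog => //; apply: alg_mul_homog.
Qed.

Definition ind_mod : mod_on (cA_alg A) ind :=
  ModOn ind_act_bilin ind_actA ind_act1 ind_act_homog.

Definition at_n (n : N) (a : A) : ind := tensB a n.

Definition ind_coact (t : ind) : H ⊠ ind :=
  teval (fun a n => tmap idfun (at_n n) (coact (cA_comod A) a)) t.

Let at_lin n : linear (at_n n).
Proof. exact: tensB_bilin.1. Qed.

Let tid_lin (V W : gradedSpace k G) (f : V -> W) :
  linear f -> linear (tmap idfun f : H ⊠ V -> H ⊠ W).
Proof. by move=> lf; apply: tmap_linear. Qed.

Let ind_coact_bal : balanced ind_ra ind_la
  (fun a n => tmap idfun (at_n n) (coact (cA_comod A) a)).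
Proof.
split.
  split=> [n|a].
    have lc : linear (coact (cA_comod A)) by exact: linearP.
    exact: (linear_comp (tid_lin (at_lin n)) lc).
  apply: linear_sumf => p.
  exact: linear_comp ((gtens_bilin H ind).2 p.1) (tensB_bilin.2 p.2).
move=> b a n; rewrite /coact /= /ind_ra cA_coactM.
have /coinvP := coinv_valP b; rewrite /coact /= => ->.
have bm := alg_mul_bilin (cA_alg_on A).
have l1 := linear_comp (tid_lin (at_lin n))
  ((colour_act_bilin chi H bm).1 (cone H ⊗ coinv_val b : H ⊠ A)).
have l2 := tid_lin (at_lin (ind_la b n)).
move: (cm_coact (cA_comod_on A) a); apply: (tens_ext l1 l2) => h a0.
rewrite colour_actE1 //; last exact: alg_one_homog.
rewrite !tmapE //; congr (_ ⊗ _); last exact: tensB_bal.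
exact: alg_mul1r.
Qed.

Lemma ind_coactE a n :
  ind_coact (tensB a n) = tmap idfun (at_n n) (coact (cA_comod A) a).
Proof. exact/tevalE/ind_coact_bal. Qed.

Lemma ind_coact_linear : linear ind_coact.
Proof. exact/teval_linear/ind_coact_bal. Qed.

Lemma ind_coact_homog g t :
  homog g t -> homog g (linear_of ind_coact_linear t).
Proof.
apply: (gbtens_homog_map (c := id)); first exact: ind_coact_linear.
move=> g' h a n ha hn; rewrite /= ind_coactE.
have := gm_homog (coact (cA_comod A)) ha.
apply: (gbtens_homog_map (c := fun g => (g * h)%g)); first exact: tid_lin.
move=> g1 g2 x a0 hx ha0; rewrite tmapE // -mulgA.
by apply: gtens_homog => //; apply: tensB_homog.
Qed.

Definition ind_coact_map : gmap ind (H ⊠ ind) := GMap ind_coact_homog.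

Lemma ind_coactA v : tmap idfun ind_coact_map (ind_coact_map v) =
  tassoc (tmap (comul H) idfun (ind_coact_map v)).
Proof.
have lcm : linear (comul H) by exact: linearP.
have lc := ind_coact_linear.
have lr (V : gradedSpace k G) :
    linear (tmap (comul H) idfun : H ⊠ V -> (H ⊠ H) ⊠ V).
  by apply: tmap_linear.
have l1 := linear_comp (tid_lin lc) lc.
have l2 := linear_comp (@tassoc_linear _ _ H H ind) (linear_comp (lr ind) lc).
move: v; apply: (tens_ext l1 l2) => a n.
rewrite -/(tensB a n) !ind_coactE.
set q := tmap idfun (at_n n) : H ⊠ A -> H ⊠ ind.
have lq : linear q by exact: tid_lin.
have lA : linear (coact (cA_comod A)) by exact: linearP.
have E1 t : tmap idfun ind_coact (q t) =
    tmap idfun q (tmap idfun (coact (cA_comod A)) t).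
  move: t; apply: (tens_ext (linear_comp (tid_lin lc) lq)
    (linear_comp (tid_lin lq) (tid_lin lA))) => h a0.
  by rewrite /q !tmapE //= ind_coactE.
have E2 t : tassoc (tmap (comul H) idfun (q t)) =
    tmap idfun q (tassoc (tmap (comul H) idfun t)).
  move: t; apply: (tens_ext
    (linear_comp (@tassoc_linear _ _ H H ind) (linear_comp (lr ind) lq))
    (linear_comp (tid_lin lq)
      (linear_comp (@tassoc_linear _ _ H H A) (lr A)))) => h a0.
  rewrite /q !tmapE //.
    have m1 := linear_comp (@tassoc_linear _ _ H H ind)
      ((gtens_bilin (H ⊠ H) ind).1 (at_n n a0)).
    have m2 := linear_comp (tid_lin lq) (linear_comp (@tassoc_linear _ _ H H A)
      ((gtens_bilin (H ⊠ H) A).1 a0)).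
    move: (comul H h); apply: (tens_ext m1 m2) => h1 h2.
    by rewrite !tassocE [RHS]tmapE // /q tmapE //; apply: at_lin.
rewrite E1 E2; congr (tmap _ _ _).
exact: (cm_coactA (cA_comod_on A)).
Qed.

Let counit_bilin (V : gradedSpace k G) :
  bilin (fun (h : H) (v : V) => (counit H h : k) *: v).
Proof.
split=> [v c x y|h c x y].
  by rewrite linearP scalerDl -scalerA.
by rewrite scalerDr !scalerA mulrC.
Qed.

Lemma ind_counit v :
  teval (fun h w => (counit H h : k) *: w) (ind_coact_map v) = v.
Proof.
have lt V := teval_linear (unbal_balanced (counit_bilin V)).
move: v; apply: tens_ext.
- exact: linear_comp (lt ind) ind_coact_linear.
- by [].
move=> a n; rewrite -/(tensB a n) /= ind_coactE.
have Ea := cm_counit (cA_comod_on A) a.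
transitivity (at_n n (teval (fun h w => (counit H h : k) *: w)
  (coact (cA_comod A) a))); last by rewrite [teval _ _]Ea.
move: (coact (cA_comod A) a).
apply: (tens_ext (linear_comp (lt ind) (tid_lin (at_lin n)))
  (linear_comp (at_lin n) (lt A))) => h a0.
have E (V : gradedSpace k G) := tevalE (unbal_balanced (counit_bilin V)).
rewrite tmapE // !E /=.
by have [_ _ ->] := linE (at_lin n).
Qed.

Definition ind_comod : comod_on H ind := ComodOn ind_coactA ind_counit.

Lemma ind_coactM a m : cm_coact ind_comod (mod_act ind_mod a m) =
  colour_act chi (mod_act ind_mod)
    (cm_coact (cA_comod_on A) a) (cm_coact ind_comod m).
Proof.
have bm := alg_mul_bilin (cA_alg_on A).
have [u1 u2] := colour_act_bilin chi H ind_act_bilin.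
have [w1 w2] := colour_act_bilin chi H bm.
have l1 := linear_comp ind_coact_linear (ind_act_bilin.2 a).
have l2 := linear_comp (u2 (cm_coact (cA_comod_on A) a)) ind_coact_linear.
move: m; apply: (tens_ext l1 l2) => a' n.
rewrite -/(tensB a' n) ind_actE !ind_coactE.
rewrite /coact /= [cm_coact _ _]cA_coactM.
have lq := tid_lin (at_lin n).
move: (cm_coact (cA_comod_on A) a') => u; move: (cm_coact (cA_comod_on A) a).
apply: (tens_ext (linear_comp lq (w1 u)) (u1 (tmap idfun (at_n n) u))) => x b.
move: u; apply: (tens_ext (linear_comp lq (w2 (x ⊗ b)))
  (linear_comp (u2 (x ⊗ b)) lq)) => y c.
rewrite tmapE //=.
pose f1 (b : A) (y : H) := tmap idfun (at_n n)
  (colour_act chi (alg_mul (cA_alg_on A)) (x ⊗ b : H ⊠ A) (y ⊗ c : H ⊠ A)).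
pose f2 (b : A) (y : H) := colour_act chi ind_act
  (x ⊗ b : H ⊠ A) (y ⊗ at_n n c : H ⊠ ind).
rewrite -/(f1 b y) -/(f2 b y).
have tA := (gtens_bilin H A); have tI := (gtens_bilin H ind).
have [z1 D1 _] := linE (linear_comp (linear_comp lq (w1 (y ⊗ c))) (tA.2 x)).
have [z2 D2 _] := linE (linear_comp (u1 (y ⊗ at_n n c)) (tA.2 x)).
elim/homog_ind: b => [||b b' Eb Eb']; first by rewrite /f1 /f2 z1 z2.
2: by move: Eb Eb'; rewrite /f1 /f2 D1 D2 => -> ->.
move=> g b hb {z1 D1 z2 D2}.
have [z1 D1 _] :=
  linE (linear_comp (linear_comp lq (w2 (x ⊗ b))) (tA.1 c)).
have [z2 D2 _] := linE (linear_comp (u2 (x ⊗ b)) (tI.1 (at_n n c))).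
elim/homog_ind: y => [||y y' Ey Ey']; first by rewrite /f1 /f2 z1 z2.
2: by move: Ey Ey'; rewrite /f1 /f2 D1 D2 => -> ->.
move=> h y hy; rewrite /f1 /f2 (colour_actE chi (H := H) bm _ _ hb hy).
rewrite (colour_actE chi (H := H) ind_act_bilin _ _ hb hy).
have [_ _ ->] := linE lq.
by rewrite tmapE // ind_actE.
Qed.

Definition indMod : hopfMod A := HopfMod ind_coactM.

End Induced.

Section InducedMap.
Variables (N P : gmod B) (f : gmodHom N P).

Definition ind_map (t : ind N) : ind P := teval (fun a n => tensB a (f n)) t.

Let ind_map_bal :
  balanced (@ind_ra) (@ind_la N) (fun a n => tensB a (f n) : ind P).
Proof.
have lf : linear f by exact: linearP.
split.
  split=> z; first exact: (tensB_bilin P).1.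
  exact: linear_comp ((tensB_bilin P).2 z) lf.
by move=> b a n; rewrite tensB_bal /ind_la gmh_act.
Qed.

Lemma ind_mapE a n : ind_map (tensB a n) = tensB a (f n).
Proof. exact/tevalE/ind_map_bal. Qed.

Lemma ind_map_linear : linear ind_map.
Proof. exact/teval_linear/ind_map_bal. Qed.

Lemma ind_map_homog g (t : ind N) :
  homog g t -> homog g (linear_of ind_map_linear t).
Proof.
apply: (gbtens_homog_map (c := id)); first exact: ind_map_linear.
move=> g' h a n ha hn; rewrite /= ind_mapE.
by apply: tensB_homog => //; apply: gm_homog.
Qed.

Definition ind_gmap : gmap (indMod N) (indMod P) := GMap ind_map_homog.

Lemma ind_map_act (a : cA_alg A) (t : hm_mod (indMod N)) :
  ind_gmap (a • t) = a • (ind_gmap t : hm_mod (indMod P)).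
Proof.
have lN := (ind_act_bilin N).2 a; have lP := (ind_act_bilin P).2 a.
move: t; apply: (tens_ext (linear_comp ind_map_linear lN)
  (linear_comp lP ind_map_linear)) => a' n.
by rewrite -/(tensB a' n) ind_actE !ind_mapE ind_actE.
Qed.

Lemma ind_map_colinear :
  colinear (M := hm_comod (indMod N)) (N := hm_comod (indMod P)) ind_gmap.
Proof.
have lm : linear (tmap idfun ind_map : H ⊠ ind N -> H ⊠ ind P).
  by apply: tmap_linear => //; apply: ind_map_linear.
apply: (tens_ext (linear_comp (@ind_coact_linear P) ind_map_linear)
  (linear_comp lm (@ind_coact_linear N))) => a n.
rewrite -/(tensB a n) ind_mapE !ind_coactE.
have lA : linear (at_n n) by exact: (tensB_bilin N).1.
have lB : linear (at_n (f n)) by exact: (tensB_bilin P).1.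
move: (coact (cA_comod A) a).
have lid (V W : gradedSpace k G) (g : V -> W) : linear g -> linear (tmap idfun g : H ⊠ V -> H ⊠ W).
  by move=> lg; apply: tmap_linear.
apply: (tens_ext (lid _ _ _ lB) (linear_comp lm (lid _ _ _ lA))) => x b.
by rewrite !tmapE //= ?ind_mapE //; apply: ind_map_linear.
Qed.

Definition ind_hom : hopfHom (indMod N) (indMod P) :=
  @HopfHom (indMod N) (indMod P) ind_gmap ind_map_act ind_map_colinear.

End InducedMap.

Lemma ind_hom1 (N : gmod B) : ind_hom (gmodHom_id N) = hopfHom_id (indMod N).
Proof.
apply: hopfHom_eq; apply: tens_ext; [exact: ind_map_linear|by []|].
by move=> a n; rewrite -/(tensB a n) /= ind_mapE.
Qed.

Lemma ind_homM (N P Q : gmod B) (g : gmodHom P Q) (f : gmodHom N P) :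
  ind_hom (gmodHom_comp g f) = hopfHom_comp (ind_hom g) (ind_hom f).
Proof.
apply: hopfHom_eq; apply: tens_ext; first exact: ind_map_linear.
  by apply: linear_comp; apply: ind_map_linear.
by move=> a n; rewrite -/(tensB a n) /= !ind_mapE.
Qed.

Definition indFunctor : functor (gmodCat B) hopfCat :=
  @Functor (gmodCat B) hopfCat indMod ind_hom ind_hom1 ind_homM.

End HopfModules.
End ModuleCategories.

(* Main.v *)
Require Import Defs.
From HB Require Import structures.
From mathcomp Require Import all_boot all_order all_algebra.
From mathcomp Require Import boolp.

(* For a Hopf module M put t(m) = θ(S(m_(-1))) m_(0).  It is a projection of M
   onto its coinvariants.  That t(m) is coinvariant is seen without computing
   Δ∘S: the bijection h ⊗ m ↦ h m_(-1) ⊗ m_(0) of H ⊗ M carries the diagonal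
   coaction to the coaction of H alone and S(m_(-1)) ⊗ m_(0) to 1 ⊗ m, so
   S(m_(-1)) ⊗ m_(0) is coinvariant, and θ(h) m is colinear in h ⊗ m.

   Maschke: a ⊗ x ↦ t(a) x is a left inverse of the unit x ↦ 1 ⊗ x and inverse
   to it on the coinvariants of A ⊗_B X.  Hence a retraction r of A ⊗_B i gives
   the retraction y ↦ (t ⊗ 1)(r(1 ⊗ y)) of i.

   Dual Maschke: if θ is multiplicative then m = θ(m_(-1)) t(m_(0)), and a
   B-linear section s of p on coinvariants extends to the section
   σ(y) = θ(y_(-1)) s(t(y_(0))) of p.  Since t(a n) = t(a) n for n coinvariant,
   σ(a n) = θ(a_(-1)) t(a_(0)) s(n) = a s(n), and A-linearity of σ follows. *)

Set Implicit Arguments.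
Unset Strict Implicit.
Unset Printing Implicit Defensive.

Import GRing.Theory.
Local Open Scope ring_scope.

(** * Sweedler sums as evaluations of tensors *)

Section Teval.
Variables (k : fieldType) (M N : lmodType k) (I : Type).
Variables (ra : I -> M -> M) (la : I -> N -> N).
Implicit Types (P Q : lmodType k) (t : btensor ra la).

Lemma eq_teval P (f f' : M -> N -> P) t :
  (forall m n, f m n = f' m n) -> teval f t = teval f' t.
Proof. by move=> E; apply: eq_bigr => p _. Qed.

Lemma linear_teval P Q (g : P -> Q) (f : M -> N -> P) t :
  linear g -> g (teval f t) = teval (fun m n => g (f m n)) t.
Proof. by move=> /linE[g0 gD _]; rewrite /teval (big_morph g gD g0). Qed.

Lemma teval_linear_param P Q (F : Q -> M -> N -> P) t :
  (forall m n, linear (fun q => F q m n)) -> linear (fun q => teval (F q) t).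
Proof. by move=> lF; apply: linear_sumf => p; apply: lF. Qed.

Lemma teval_tens t : teval (fun m n => tens m n) t = t.
Proof. by rewrite [RHS]tens_sum. Qed.

End Teval.

Section TevalGraded.
Variables (k : fieldType) (G : groupType).
Implicit Types U V W : gradedSpace k G.

Lemma teval_lin U V (P : lmodType k) (f : U -> V -> P) :
  bilin f -> linear (teval f : U ⊠ V -> P).
Proof. by move=> bf; apply/teval_linear/unbal_balanced. Qed.

Lemma teval_pure U V (P : lmodType k) (f : U -> V -> P) u v :
  bilin f -> teval f (u ⊗ v : U ⊠ V) = f u v.
Proof. by move=> bf; apply/tevalE/unbal_balanced. Qed.

Lemma teval_tmap U U' V V' (P : lmodType k) (f : U' -> V' -> P)
    (g : U -> U') (h : V -> V') (t : U ⊠ V) :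
  bilin f -> linear g -> linear h ->
  teval f (tmap g h t) = teval (fun u v => f (g u) (h v)) t.
Proof.
move=> bf lg lh; rewrite /tmap (linear_teval _ _ (teval_lin bf)).
by apply: eq_teval => u v; rewrite teval_pure.
Qed.

Lemma teval_tassoc U V W (P : lmodType k) (f : U -> V ⊠ W -> P)
    (t : (U ⊠ V) ⊠ W) : bilin f ->
  teval f (tassoc t) =
  teval (fun (p : U ⊠ V) w => teval (fun u v => f u (v ⊗ w)) p) t.
Proof.
move=> bf; rewrite /tassoc (linear_teval _ _ (teval_lin bf)).
apply: eq_teval => p w; rewrite (linear_teval _ _ (teval_lin bf)).
by apply: eq_teval => u v; rewrite teval_pure.
Qed.

Definition trilin (U V W P : lmodType k) (T : U -> V -> W -> P) : Prop :=
  [/\ forall v w, linear (fun u => T u v w), forall u w, linear (fun v => T u v w)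
    & forall u v, linear (T u v)].

(** The colour factor of [colour_act] is explicit only on homogeneous entries; identities between
    colour actions are reduced to that case. *)
Lemma bilin_homog_ext U V (P : lmodType k) (f f' : U -> V -> P) :
  bilin f -> bilin f' ->
  (forall g h u v, homog g u -> homog h v -> f u v = f' u v) ->
  forall u v, f u v = f' u v.
Proof.
move=> [f1 f2] [f1' f2'] E u v.
elim/homog_ind: u => [|g u hu|x y Ex Ey].
- by have [-> _ _] := linE (f1 v); have [-> _ _] := linE (f1' v).
- elim/homog_ind: v => [|h v hv|x y Ex Ey].
  + by have [-> _ _] := linE (f2 u); have [-> _ _] := linE (f2' u).
  + exact: E hu hv.
  + by have [_ -> _] := linE (f2 u); have [_ -> _] := linE (f2' u); rewrite Ex Ey.
- by have [_ -> _] := linE (f1 v); have [_ -> _] := linE (f1' v); rewrite Ex Ey.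
Qed.

End TevalGraded.

(** * Sweedler calculus for comodules over a colour Hopf algebra *)

Section Sweedler.
Variables (k : fieldType) (G : groupType) (chi : bicharacter k G).
Variable H : colourHopf chi.

Lemma coact_linear (M : gcomod H) : linear (coact M).
Proof. exact: linearP. Qed.

Lemma comul_linear : linear (comul H).
Proof. exact: linearP. Qed.

Lemma antipode_linear : linear (antipode H).
Proof. exact: linearP. Qed.

Lemma cmul_bilin (R : colourAlg k G) : bilin (@cmul k G R).
Proof. exact: alg_mul_bilin. Qed.

Lemma act_bilin (R : colourAlg k G) (M : gmod R) : bilin (@act k G R M).
Proof. exact: mod_act_bilin. Qed.

Lemma teval_coact_linear (M : gcomod H) (P : lmodType k) (f : H -> M -> P) :
  bilin f -> linear (fun m => teval f (coact M m)).
Proof. by move=> bf; exact: linear_comp (teval_lin bf) (@coact_linear M). Qed.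

(** Both sides are values of the linear map x ⊗ (y ⊗ m') ↦ [T x y m'], taken on the two sides of the
    axiom [cm_coactA]. *)
Lemma coact_coassoc (M : gcomod H) (P : lmodType k) (T : H -> H -> M -> P) m :
  trilin T ->
  teval (fun x m' => teval (T x) (coact M m')) (coact M m) =
  teval (fun x m' => teval (fun x1 x2 => T x1 x2 m') (comul H x)) (coact M m).
Proof.
move=> [T1 T2 T3].
have bT x : bilin (T x) by split=> ?; [apply: T2|apply: T3].
have bf : bilin (fun x (u : H ⊠ M) => teval (T x) u).
  split=> [u|x]; last exact: teval_lin.
  by apply: teval_linear_param => y m'; apply: T1.
have bD m' : bilin (fun x1 x2 => T x1 x2 m') by split=> ?; [apply: T1|apply: T2].
have := congr1 (teval (fun x (u : H ⊠ M) => teval (T x) u))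
  (cm_coactA (cm_comod M) m).
rewrite teval_tmap //; last exact: coact_linear.
move=> ->; rewrite teval_tassoc //.
have E p m' : teval (fun x1 x2 => teval (T x1) (x2 ⊗ m' : H ⊠ M)) p =
    teval (fun x1 x2 => T x1 x2 m') (p : H ⊠ H).
  by apply: eq_teval => x1 x2; rewrite teval_pure.
apply: etrans (eq_teval _ E) _.
apply: (teval_tmap (f := fun (p : H ⊠ H) m' => teval (fun x1 x2 => T x1 x2 m') p)) => //.
  2: exact: comul_linear.
split=> [m'|p]; first exact: teval_lin.
by apply: teval_linear_param => x1 x2; apply: T3.
Qed.

Lemma coact_counit (M : gcomod H) (P : lmodType k) (f : M -> P) m :
  linear f -> teval (fun h m' => (counit H h : k) *: f m') (coact M m) = f m.
Proof.
move=> lf; rewrite -{2}(cm_counit (cm_comod M) m) (linear_teval _ _ lf).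
by apply: eq_teval => h m'; have [_ _ ->] := linE lf.
Qed.

Lemma antipode_cancelr (P : lmodType k) (f : H -> P) h : linear f ->
  teval (fun x y => f (x ⋅ antipode H y)) (comul H h) =
  (counit H h : k) *: f (cone H).
Proof.
move=> lf; have [_ _ <-] := linE lf.
by rewrite -antipoder (linear_teval _ _ lf).
Qed.

Lemma antipode_cancell (P : lmodType k) (f : H -> P) h : linear f ->
  teval (fun x y => f (antipode H x ⋅ y)) (comul H h) =
  (counit H h : k) *: f (cone H).
Proof.
move=> lf; have [_ _ <-] := linE lf.
by rewrite -antipodel (linear_teval _ _ lf).
Qed.

Lemma antipode1 : antipode H (cone H) = cone H.
Proof.
have bS : bilin (fun x y => x ⋅ antipode H y).
  exact: (bilin_comp (cmul_bilin H) (fun _ _ _ => erefl) antipode_linear).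
have := antipoder (cone H); rewrite comul1 teval_pure // counit1 scale1r => E.
exact: etrans (esym (alg_mul1l (ca_alg H) _)) E.
Qed.

(** * Colour actions: functoriality and coassociativity *)

Section ColourAction.
Implicit Types U V W : gradedSpace k G.

Lemma colour_act_post U V W W' (op : U -> V -> W) (f : W -> W')
    (t : H ⊠ U) (u : H ⊠ V) : linear f ->
  tmap idfun f (colour_act chi op t u) =
  colour_act chi (fun a m => f (op a m)) t u.
Proof.
move=> lf; have lif : linear (tmap idfun f : H ⊠ W -> H ⊠ W').
  by apply: tmap_linear.
have [z D Z] := linE lif.
rewrite (linear_teval _ _ lif); apply: eq_teval => x a.
rewrite (linear_teval _ _ lif); apply: eq_teval => y m.
rewrite /hext (big_morph _ D z); apply: eq_bigr => p _.
by rewrite (big_morph _ D z); apply: eq_bigr => q _; rewrite Z tmapE.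
Qed.

(** Since [f] preserves degrees, the colour factor (|a| / |y|) is the same before and after applying
    it. *)
Lemma colour_act_pre U U' V W (op : U' -> V -> W) (f : gmap U U')
    (t : H ⊠ U) (u : H ⊠ V) : bilin op ->
  colour_act chi op (tmap idfun f t) u =
  colour_act chi (fun a m => op (f a) m) t u.
Proof.
move=> bop; have lf : linear f by exact: linearP.
have bop' : bilin (fun a m => op (f a) m) by exact: (bilin_comp bop lf).
have [b1 b2] := colour_act_bilin chi H bop.
have [c1 c2] := colour_act_bilin chi H bop'.
have lif : linear (tmap idfun f : H ⊠ U -> H ⊠ U') by apply: tmap_linear.
move: t; apply: (tens_ext (linear_comp (b1 u) lif) (c1 u)) => x a.
move: u; apply: (tens_ext (b2 _) (c2 _)) => y m; rewrite tmapE //=.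
have [s1 s2] := gtens_bilin H U; have [s1' s2'] := gtens_bilin H U'.
have [r1 r2] := gtens_bilin H V.
move: a y; apply: bilin_homog_ext => [||g h a y ha hy].
- split=> [y|a]; first exact: linear_comp (b1 _) (linear_comp (s2' x) lf).
  exact: linear_comp (b2 _) (r1 m).
- split=> [y|a]; first exact: linear_comp (c1 _) (s2 x).
  exact: linear_comp (c2 _) (r1 m).
by rewrite (colour_actE _ bop _ _ (gm_homog f ha) hy) (colour_actE _ bop' _ _ ha hy).
Qed.

(** The colour factor involves only |a| and the degree of the first leg of m, and both bracketings
    of the iterated coaction share that leg; so coassociativity passes through the colour action. *)
Lemma colour_act_coassoc (M : gcomod H) U W (op : U -> H -> M -> W)
    (t : H ⊠ U) (m : M) : trilin op ->
  colour_act chi (fun a m' => teval (op a) (coact M m')) t (coact M m) =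
  teval (fun y m' => colour_act chi (fun a z => op a z m') t (comul H y))
    (coact M m).
Proof.
move=> [o1 o2 o3].
have bo2 m' : bilin (fun a z => op a z m') by split=> ?; [apply: o1|apply: o2].
have bop : bilin (fun a m' => teval (op a) (coact M m')).
  split=> [m'|a]; first by apply: teval_linear_param => z m''; apply: o1.
  by apply: teval_coact_linear; split=> ?; [apply: o2|apply: o3].
have [b1 b2] := colour_act_bilin chi H bop.
have c m' := colour_act_bilin chi H (bo2 m').
have lR : linear (fun t : H ⊠ U => teval (fun y m' =>
    colour_act chi (fun a z => op a z m') t (comul H y)) (coact M m)).
  by apply: teval_linear_param => y m'; exact: (c m').1.
move: t; apply: (tens_ext (b1 _) lR) => x a.
pose T (y z : H) (m' : M) : H ⊠ W :=
  colour_act chi (fun a z => op a z m') (x ⊗ a : H ⊠ U) (y ⊗ z : H ⊠ H).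
have [s1 s2] := gtens_bilin H U; have [h1 h2] := gtens_bilin H H.
have [w1 w2] := gtens_bilin H W; have [r1 r2] := gtens_bilin H M.
have lo3 (t : H ⊠ U) (u : H ⊠ H) :
    linear (fun m' => colour_act chi (fun a z => op a z m') t u).
  apply: teval_linear_param => x' a'; apply: teval_linear_param => y z.
  do 2!apply: linear_sumf => ?.
  exact/linear_scalef/(linear_comp (w2 _) (o3 _ _)).
have tT : trilin T.
  split=> [z m'|y m'|y z]; last exact: lo3.
    exact: linear_comp ((c m').2 _) (h1 z).
  exact: linear_comp ((c m').2 _) (h2 y).
transitivity (teval (fun y m' => teval (T y) (coact M m')) (coact M m)); last first.
  rewrite coact_coassoc //; apply: eq_teval => y m'.
  rewrite -[comul H y in RHS]teval_tens.
  by rewrite (linear_teval _ _ ((c m').2 (x ⊗ a : H ⊠ U))).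
rewrite -[coact M m in LHS]teval_tens (linear_teval _ _ (b2 (x ⊗ a : H ⊠ U))).
apply: eq_teval => y m'; rewrite /T {T tT lR}.
move: a y; apply: bilin_homog_ext => [||g h a y ha hy].
- split=> [y|a]; first exact: linear_comp (b1 _) (s2 x).
  exact: linear_comp (b2 _) (r1 _).
- split=> [y|a]; apply: teval_linear_param => z m''.
    exact: linear_comp ((c m'').1 _) (s2 x).
  exact: linear_comp ((c m'').2 _) (h1 _).
rewrite (colour_actE _ bop _ _ ha hy) (linear_teval _ _ (w2 _)).
have lZ : linear ( *:%R (chi g h) : H ⊠ W -> H ⊠ W).
  exact: linear_scalef (fun _ _ _ => erefl).
rewrite (linear_teval _ _ lZ).
by apply: eq_teval => z m''; rewrite (colour_actE _ (bo2 m'') _ _ ha hy).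
Qed.

(** The unit has degree e and χ(g, e) = 1, so no colour factor survives. *)
Lemma colour_act_one U V W (op : U -> V -> W) (t : H ⊠ U) v : bilin op ->
  colour_act chi op t (cone H ⊗ v : H ⊠ V) = tmap idfun (op^~ v) t.
Proof.
move=> bop; have lo := bop.1 v; have [b1 _] := colour_act_bilin chi H bop.
have lo' : linear (tmap idfun (op^~ v) : H ⊠ U -> H ⊠ W) by apply: tmap_linear.
move: t; apply: (tens_ext (b1 _) lo') => x a.
rewrite colour_actE1 //; last exact: alg_one_homog.
by rewrite tmapE //; congr (_ ⊗ _); apply: alg_mul1r.
Qed.

End ColourAction.

(** * Untwisting the diagonal coaction *)

Section Twist.
Variable M : gcomod H.

(* [h ⊗ m ↦ h s(m_(-1)) ⊗ m_(0)] *)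
Definition twist (s : H -> H) (t : H ⊠ M) : H ⊠ M :=
  teval (fun h m => teval (fun y m' => (h ⋅ s y) ⊗ m' : H ⊠ M) (coact M m)) t.

Section TwistLinear.
Variables (s : H -> H) (ls : linear s).

Let twist_in_bilin h : bilin (fun y m' => (h ⋅ s y) ⊗ m' : H ⊠ M).
Proof.
apply: (bilin_comp (gtens_bilin H M) _ (fun _ _ _ => erefl)).
exact: linear_comp ((cmul_bilin H).2 h) ls.
Qed.

Let twist_bilin : bilin (fun (h : H) m =>
  teval (fun y m' => (h ⋅ s y) ⊗ m' : H ⊠ M) (coact M m)).
Proof.
split=> [m|h]; last exact: teval_coact_linear (twist_in_bilin h).
apply: teval_linear_param => y m'.
exact: linear_comp ((gtens_bilin H M).1 m') ((cmul_bilin H).1 (s y)).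
Qed.

Lemma twist_linear : linear (twist s).
Proof. exact: teval_lin. Qed.

Lemma twistE h m : twist s (h ⊗ m) =
  teval (fun y m' => (h ⋅ s y) ⊗ m' : H ⊠ M) (coact M m).
Proof. exact: teval_pure. Qed.

End TwistLinear.

(** By coassociativity, twisting by [s'] and then by [s] is twisting by the convolution product h ↦
    s'(h_1) s(h_2), which the hypothesis makes h ↦ ε(h) 1. The hypothesis carries a linear [f]
    because it is applied under x ↦ (h x) ⊗ m'. *)
Lemma twistK (s s' : H -> H) : linear s -> linear s' ->
  (forall (P : lmodType k) (f : H -> P) h, linear f ->
    teval (fun x y => f (s' x ⋅ s y)) (comul H h) =
    (counit H h : k) *: f (cone H)) ->
  forall t, twist s (twist s' t) = t.
Proof.
move=> ls ls' conv; have lt := twist_linear ls; have lt' := twist_linear ls'.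
have [c1 c2] := cmul_bilin H; have [t1 t2] := gtens_bilin H M.
apply: (tens_ext (linear_comp lt lt') (fun _ _ _ => erefl)) => h m.
rewrite twistE // (linear_teval _ _ lt).
under eq_teval => y m' do rewrite twistE //.
rewrite (coact_coassoc (T := fun y z m' => (h ⋅ s' y ⋅ s z) ⊗ m' : H ⊠ M)).
  (* h ⊗ m is expanded to the sum of ε(m_(-1)) (h 1) ⊗ m_(0), the shape that [conv] produces. *)
  rewrite -[h in RHS](alg_mul1r (ca_alg H)) -(coact_counit _ (t2 _)).
  apply: eq_teval => y m'.
  rewrite -(conv _ (fun x => (h ⋅ x) ⊗ m' : H ⊠ M)).
    by apply: eq_teval => x1 x2; rewrite /cmul (alg_mulA (ca_alg H)).
  exact: linear_comp (t1 m') (c2 h).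
split=> [z m'|y m'|y z]; last exact: t2.
  apply: linear_comp (t1 m') _.
  exact: linear_comp (c1 _) (linear_comp (c2 h) ls').
exact: linear_comp (t1 m') (linear_comp (c2 _) ls).
Qed.

(** With x ⊗ m' as operation, [colour_act] gives (|h_2| / |m_(-1)|) h_1 m_(-1) ⊗ (h_2 ⊗ m_(0)), the
    coaction on a tensor product of comodules. *)
Definition diag_coact (t : H ⊠ M) : H ⊠ (H ⊠ M) :=
  teval (fun h m => colour_act chi (fun x m' => x ⊗ m' : H ⊠ M)
    (comul H h) (coact M m)) t.

Let diag_bilin : bilin (fun h m => colour_act chi (fun x m' => x ⊗ m' : H ⊠ M)
  (comul H h) (coact M m)).
Proof.
apply: bilin_comp (@comul_linear) (@coact_linear M).
exact: colour_act_bilin (gtens_bilin H M).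
Qed.

Lemma diag_coact_linear : linear diag_coact.
Proof. exact: teval_lin. Qed.

Lemma diag_coactE h m : diag_coact (h ⊗ m) =
  colour_act chi (fun x m' => x ⊗ m' : H ⊠ M) (comul H h) (coact M m).
Proof. exact: teval_pure. Qed.

(* [twist idfun] untwists the diagonal coaction into the coaction of [H]
   alone: it is colinear from [diag_coact] to [Δ ⊗ id]. *)
Lemma twist_diag_coact t : tmap idfun (twist idfun) (diag_coact t) =
  tassoc (tmap (comul H) idfun (twist idfun t)).
Proof.
have lid : linear (idfun : H -> H) by [].
have lt := twist_linear lid.
have lit : linear (tmap idfun (twist idfun) : H ⊠ (H ⊠ M) -> H ⊠ (H ⊠ M)).
  exact: tmap_linear.
have lD : linear (tmap (comul H) idfun : H ⊠ M -> (H ⊠ H) ⊠ M).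
  by apply: tmap_linear => //; apply: comul_linear.
have lA := linear_comp (@tassoc_linear _ _ H H M) lD.
move: t; apply: (tens_ext (linear_comp lit diag_coact_linear) (linear_comp lA lt)).
move=> h m; rewrite diag_coactE twistE // (linear_teval _ _ lA).
rewrite colour_act_post //.
have [t1 t2] := gtens_bilin H M; have [c1 c2] := cmul_bilin H.
have -> : (fun (a : H) m' => twist idfun (a ⊗ m')) = (fun a m' =>
    teval ((fun a y m'' => (a ⋅ y) ⊗ m'' : H ⊠ M) a) (coact M m')).
  by apply/funext => a; apply/funext => m'; rewrite twistE.
rewrite colour_act_coassoc; last first.
  split=> [y m'|a m'|a y]; last exact: t2.
    exact: linear_comp (t1 m') (c1 y).
  exact: linear_comp (t1 m') (c2 a).
apply: eq_teval => y m'.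
(* What remains is Δ(h) Δ(y) = Δ(h y), with m' carried along. *)
rewrite -(colour_act_post (@cmul k G H) _ _ (t1 m')).
rewrite tmapE //; last exact: comul_linear.
by rewrite /= comulM /tassoc teval_pure //; apply: tassoc_bilin.
Qed.

Lemma diag_coact_coinv m :
  let w := twist (antipode H) (cone H ⊗ m) in diag_coact w = cone H ⊗ w.
Proof.
set w := twist _ _ => /=.
have lid : linear (idfun : H -> H) by [].
have lS := antipode_linear.
have lti := twist_linear lid; have ltS := twist_linear lS.
(* Both antipode identities are used: h_1 S(h_2) = ε(h) 1 gives this injectivity, and S(h_1) h_2 =
   ε(h) 1 gives [twist idfun w] = 1 ⊗ m below. *)
have itK : cancel (tmap idfun (twist idfun) : H ⊠ (H ⊠ M) -> H ⊠ (H ⊠ M))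
    (tmap idfun (twist (antipode H))).
  apply: (tens_ext (f := fun t => tmap idfun _ (tmap idfun _ t))).
  - by apply: linear_comp; apply: tmap_linear.
  - by [].
  move=> h t; rewrite !tmapE //= (twistK lS lid) // => P f h'.
  exact: antipode_cancelr.
apply: (can_inj itK); rewrite twist_diag_coact tmapE //.
have -> : twist idfun w = cone H ⊗ m.
  by apply: (twistK lid lS) => P f h'; apply: antipode_cancell.
rewrite tmapE //; last exact: comul_linear.
by rewrite comul1 tassocE.
Qed.

End Twist.

End Sweedler.

(** * The trace attached to a total integral θ *)

Section TotalIntegral.
Variables (k : fieldType) (G : groupType) (chi : bicharacter k G).
Variables (H : colourHopf chi) (A : comodAlg H) (theta : gmap H A).
Hypothesis theta_colinear : colinear (M := Hcomod H) (N := cA_comod A) theta.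
Hypothesis theta1 : theta (cone H) = cone (cA_alg A).

Local Notation "a ∗ m" := (mod_act (hm_mod_on _) a m)
  (at level 40, left associativity) : ring_scope.

Lemma theta_linear : linear theta.
Proof. exact: linearP. Qed.

Lemma hact_bilin (M : hopfMod A) : bilin (mod_act (hm_mod_on M)).
Proof. exact: mod_act_bilin. Qed.

(** The leg of m in H is 1, of degree e, so it adds neither a factor in H nor a colour factor: a ↦ a
    m is colinear from A to M. *)
Lemma coact_act_coinv (M : hopfMod A) (a : A) (m : M) :
  m \in coinv_pred (hm_comod M) ->
  coact (hm_comod M) (a ∗ m) =
  tmap idfun (fun a' => a' ∗ m : M) (coact (cA_comod A) a).
Proof.
move=> /coinvP Em; rewrite /coact /= hm_coactM.
rewrite -[cm_coact (hm_comod_on M) m]/(coact (hm_comod M) m) Em.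
exact: colour_act_one (hact_bilin M).
Qed.

Section Trace.
Variable M : hopfMod A.

Definition trace (m : M) : M :=
  teval (fun h m' => theta (antipode H h) ∗ m' : M) (coact (hm_comod M) m).

Let thetaS_linear : linear (fun h => theta (antipode H h)).
Proof. exact: linear_comp theta_linear (@antipode_linear _ _ _ H). Qed.

Let theta_act_bilin : bilin (fun h m => theta h ∗ m : M).
Proof. exact: (bilin_comp (hact_bilin M) theta_linear (fun _ _ _ => erefl)). Qed.

Let trace_bilin : bilin (fun h m => theta (antipode H h) ∗ m : M).
Proof. exact: (bilin_comp (hact_bilin M) thetaS_linear (fun _ _ _ => erefl)). Qed.

Lemma trace_linear : linear trace.
Proof. exact: (teval_coact_linear (M := hm_comod M) trace_bilin). Qed.

Lemma trace_homog g m : homog g m -> homog g (trace m).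
Proof.
move=> hm; have := gm_homog (coact (hm_comod M)) hm.
apply: (gbtens_homog_map (c := id)); first exact: teval_lin.
move=> g' h x m' hx hm'; rewrite teval_pure //.
by apply: mod_act_homog => //; do 2!apply: gm_homog.
Qed.

Definition theta_act (t : H ⊠ M) : M := teval (fun h m => theta h ∗ m : M) t.

Lemma theta_actE h m : theta_act (h ⊗ m) = theta h ∗ m.
Proof. exact: teval_pure. Qed.

Lemma theta_act_linear : linear theta_act.
Proof. exact: teval_lin. Qed.

(** Colinearity turns the coaction of θ(h) into h_1 ⊗ θ(h_2), and as θ preserves degrees the colour
    factor is still (|h_2| / |m_(-1)|). *)
Lemma coact_theta_act t : coact (hm_comod M) (theta_act t) =
  tmap idfun theta_act (diag_coact (M := hm_comod M) t).
Proof.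
have lT := theta_act_linear.
have lc := @coact_linear _ _ _ _ (hm_comod M).
have liT : linear (tmap idfun theta_act : H ⊠ (H ⊠ M) -> H ⊠ M).
  exact: tmap_linear.
move: t; apply: (tens_ext (linear_comp lc lT)
  (linear_comp liT (@diag_coact_linear _ _ _ _ (hm_comod M)))) => h m.
rewrite diag_coactE theta_actE colour_act_post // {1}/coact /= hm_coactM.
have := theta_colinear h; rewrite /coact /= => ->.
rewrite (colour_act_pre theta _ _ (hact_bilin M)).
congr colour_act; apply/funext => x; apply/funext => m'.
by rewrite theta_actE.
Qed.

Lemma trace_coinv m : trace m \in coinv_pred (hm_comod M).
Proof.
apply/coinvP; set w := twist (M := hm_comod M) (antipode H) (cone H ⊗ m).
have -> : trace m = theta_act w.
  rewrite /w twistE; last exact: antipode_linear.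
  rewrite (linear_teval _ _ theta_act_linear).
  apply: eq_teval => h m'; rewrite theta_actE.
  by congr (theta _ ∗ _); apply/esym/(alg_mul1l (ca_alg H)).
rewrite coact_theta_act (diag_coact_coinv (M := hm_comod M)) tmapE //.
exact: theta_act_linear.
Qed.

Lemma trace_id m : m \in coinv_pred (hm_comod M) -> trace m = m.
Proof.
move=> /coinvP Em; rewrite /trace Em teval_pure // antipode1 theta1.
exact: mod_act1.
Qed.

End Trace.

Lemma regular_actA (r s v : A) : alg_mul (cA_alg_on A)
  (@cmul k G (cA_alg A) r s) v =
  alg_mul (cA_alg_on A) r (alg_mul (cA_alg_on A) s v).
Proof. exact/esym/(alg_mulA (cA_alg_on A)). Qed.

Definition regular_mod : mod_on (cA_alg A) A :=
  @ModOn _ _ (cA_alg A) A _ (alg_mul_bilin _) regular_actA (alg_mul1l _)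
    (alg_mul_homog _).

(** Specialises [trace] to A itself, where it takes values in B. *)
Definition regular : hopfMod A :=
  HopfMod (hm_mod_on := regular_mod) (@cA_coactM _ _ _ _ A).

(** Only a contributes a leg in H, so m factors out on the right by associativity of the action. *)
Lemma trace_act_coinv (M : hopfMod A) (a : A) (m : M) :
  m \in coinv_pred (hm_comod M) -> trace (a ∗ m : M) = trace (a : regular) ∗ m.
Proof.
move=> cm; rewrite /trace coact_act_coinv // teval_tmap //.
- rewrite (linear_teval _ _ ((hact_bilin M).1 m)); apply: eq_teval => h a'.
  by rewrite -mod_actA.
- apply: (bilin_comp (hact_bilin M) _ (fun _ _ _ => erefl)).
  exact: linear_comp theta_linear (@antipode_linear _ _ _ H).
- exact: (hact_bilin M).1.
Qed.

Local Notation B := (coinvAlg A).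

Definition traceB (a : A) : B := Coinv (trace_coinv (M := regular) a).

Lemma traceB_linear : linear traceB.
Proof. by move=> c x y; apply: val_inj; apply: (trace_linear (M := regular)). Qed.

Lemma traceB_homog g a : homog g a -> homog g (traceB a).
Proof. exact: (trace_homog (M := regular)). Qed.

Lemma traceB_val (b : B) : traceB (coinv_val b) = b.
Proof. by apply: val_inj; apply: (trace_id (M := regular)); apply: coinv_valP. Qed.

(** This is the balancing condition under which a ⊗ x ↦ t(a) x is defined on A ⊗_B X. *)
Lemma traceB_ra (b : B) (a : A) : traceB (ind_ra b a) = traceB a ⋅ b.
Proof.
apply: val_inj; apply: (trace_act_coinv (M := regular) a).
exact: (coinv_valP b).
Qed.

(** * The unit X → A ⊗_B X and its inverse on coinvariants *)

Section Unit.
Variable X : gmod B.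

Definition unitB (x : X) : indMod X := tensB (cone (cA_alg A)) x.

Lemma unitB_linear : linear unitB.
Proof. exact: (tensB_bilin X).2. Qed.

Lemma unitB_homog g x : homog g x -> homog g (unitB x).
Proof.
move=> hx; rewrite -[g]mul1g; apply: tensB_homog => //.
exact: (alg_one_homog (cA_alg_on A)).
Qed.

Lemma unitB_coinv x : unitB x \in coinv_pred (hm_comod (indMod X)).
Proof.
apply/coinvP; apply: etrans (ind_coactE _ _) _.
rewrite /coact /= [cm_coact _ _]cA_coact1 tmapE //.
exact: (tensB_bilin X).1.
Qed.

(** Exhibits each pure tensor as an element of A acting on a coinvariant, so that [trace_act_coinv]
    applies. *)
Lemma act_unitB (a : A) x : a ∗ unitB x = tensB a x :> indMod X.
Proof.
by apply: etrans (ind_actE _ _ _) _; congr tensB; apply: (alg_mul1r (cA_alg_on A)).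
Qed.

Lemma unitB_act (b : B) x : unitB (b • x) = (coinv_val b : A) ∗ unitB x.
Proof.
rewrite act_unitB /unitB -tensB_bal; congr tensB.
exact: (alg_mul1l (cA_alg_on A)).
Qed.

Definition unit_inv (t : indMod X) : X := teval (fun a x => traceB a • x) t.

Let unit_inv_bal : balanced (@ind_ra _ _ _ _ A) (@ind_la _ _ _ _ A X)
  (fun a x => traceB a • x).
Proof.
split; last by move=> b a x; rewrite traceB_ra [LHS](mod_actA (md_mod X)).
exact: (bilin_comp (act_bilin X) traceB_linear (fun _ _ _ => erefl)).
Qed.

Lemma unit_inv_linear : linear unit_inv.
Proof. exact/teval_linear/unit_inv_bal. Qed.

Lemma unit_invE a x : unit_inv (tensB a x) = traceB a • x.
Proof. exact/tevalE/unit_inv_bal. Qed.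

Lemma unit_inv_homog g t : homog g t -> homog g (unit_inv t).
Proof.
apply: (gbtens_homog_map (c := id)); first exact: unit_inv_linear.
move=> g' h a x ha hx; rewrite -/(tensB a x) unit_invE.
by apply: mod_act_homog => //; apply: traceB_homog.
Qed.

Lemma unitBK : cancel unitB unit_inv.
Proof.
move=> x; rewrite /unitB unit_invE.
(* The unit of A is the underlying element of the unit of B, so [traceB] sends it to 1. *)
by rewrite (traceB_val (cone B)); apply: mod_act1.
Qed.

(* So the trace of [A ⊗_B X], which fixes the coinvariants, exhibits [unit_inv]
   as the inverse of [unitB] on them; this makes [unit_inv] left [B]-linear
   there, although [traceB] is only right [B]-linear. *)
Lemma trace_ind t : trace (M := indMod X) t = unitB (unit_inv t).
Proof.
have l1 := @trace_linear (indMod X).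
have l2 := linear_comp unitB_linear unit_inv_linear.
move: t; apply: (tens_ext l1 l2) => a x.
rewrite -/(tensB a x) unit_invE unitB_act -act_unitB.
exact: trace_act_coinv (unitB_coinv x).
Qed.

Lemma unit_invK t : t \in coinv_pred (hm_comod (indMod X)) ->
  unitB (unit_inv t) = t.
Proof. by move=> ct; rewrite -trace_ind; apply: trace_id. Qed.

(** A coinvariant t equals 1 ⊗ x with x = [unit_inv t], and b (1 ⊗ x) = 1 ⊗ b x. *)
Lemma unit_inv_act (b : B) t : t \in coinv_pred (hm_comod (indMod X)) ->
  unit_inv ((coinv_val b : A) ∗ t) = b • unit_inv t.
Proof. by move=> /unit_invK {1}<-; rewrite -unitB_act unitBK. Qed.

End Unit.

(** * Descending retractions to B-modules *)

Section Retraction.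
Variables (X Y : gmod B) (r : hopfHom (indMod Y) (indMod X)).

Definition retract (y : Y) : X := unit_inv (r (unitB y)).

Lemma retract_linear : linear retract.
Proof.
have lr : linear r by exact: linearP.
exact: linear_comp (@unit_inv_linear X) (linear_comp lr (@unitB_linear Y)).
Qed.

Lemma retract_homog g y : homog g y -> homog g (linear_of retract_linear y).
Proof. by move=> hy; apply/unit_inv_homog/gm_homog/unitB_homog. Qed.

(** The colinear map [r] sends 1 ⊗ y to a coinvariant, and on coinvariants [unit_inv] is left
    B-linear. *)
Lemma retract_act (b : B) (y : Y) :
  GMap retract_homog (b • y) = b • (GMap retract_homog y : X).
Proof.
rewrite /= /retract unitB_act -unit_inv_act.
  by congr unit_inv; apply: (hh_act r).
exact: (coinv_mapP r (Coinv (unitB_coinv y))).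
Qed.

Definition retract_hom : gmodHom Y X := GModHom retract_act.

End Retraction.

Lemma ind_Maschke : Maschke (indFunctor A).
Proof.
move=> I X Y i [r ri] f; exists (gmodHom_comp f (retract_hom r)).
apply: gmodHom_eq => x /=; congr (f _).
(* The map [r] undoes A ⊗ i at 1 ⊗ x, and A ⊗ i sends 1 ⊗ x to 1 ⊗ i(x). *)
have E := congr1 (fun h : hopfHom (indMod X) (indMod X) => h (unitB x)) ri.
rewrite /retract -[RHS]unitBK; congr unit_inv; rewrite -[RHS]E /=; congr (r _).
exact/esym/ind_mapE.
Qed.

(** * Extending sections from coinvariants when θ is multiplicative *)

Section Extension.
Hypothesis theta_alg : is_alg_map (A := H) (B := cA_alg A) theta.

(** Multiplicativity merges the two values of θ into one; coassociativity and h_1 S(h_2) = ε(h) 1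
    then leave θ(1) m = m. *)
Lemma theta_trace (M : hopfMod A) (m : M) :
  teval (fun h m' => theta h ∗ trace m' : M) (coact (hm_comod M) m) = m.
Proof.
have [_ tM] := theta_alg; have [a1 a2] := hact_bilin M.
have lS := @antipode_linear _ _ _ H; have [c1 c2] := cmul_bilin H.
have E x m' : theta x ∗ trace m' = teval (fun y m'' =>
    theta (x ⋅ antipode H y) ∗ m'' : M) (coact (hm_comod M) m').
  rewrite (linear_teval _ _ (a2 _)); apply: eq_teval => y m''.
  by rewrite tM -mod_actA.
rewrite (eq_teval _ E).
rewrite (coact_coassoc (M := hm_comod M)
  (T := fun x y (m'' : M) => theta (x ⋅ antipode H y) ∗ m'')).
  rewrite -[RHS](mod_act1 (hm_mod_on M)) -theta1 -(coact_counit (M := hm_comod M) _ (a2 _)).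
  apply: eq_teval => y m'.
  rewrite -(antipode_cancelr (f := fun x => theta x ∗ m' : M)) //.
  exact: linear_comp (a1 m') theta_linear.
have lt m'' := linear_comp (a1 m'') theta_linear.
split=> [z m''|x m''|x y]; last exact: a2.
  exact: linear_comp (lt m'') (c1 _).
exact: linear_comp (lt m'') (linear_comp (c2 _) lS).
Qed.

Variables (X Y : hopfMod A) (s : gmodHom (coinvMod Y) (coinvMod X)).

Definition traceC (y : Y) : coinvMod Y := Coinv (trace_coinv y).

Lemma traceC_linear : linear traceC.
Proof. by move=> c x y; apply: val_inj; apply: trace_linear. Qed.

Definition strace (y : Y) : X := coinv_val (s (traceC y)).

Lemma strace_linear : linear strace.
Proof.
have lv : linear (fun x : coinvMod X => coinv_val x : X) by [].
have ls : linear s by exact: linearP.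
exact: linear_comp lv (linear_comp ls traceC_linear).
Qed.

Lemma strace_coinv y : strace y \in coinv_pred (hm_comod X).
Proof. exact: coinv_valP. Qed.

Lemma strace_homog g y : homog g y -> homog g (strace y).
Proof. by move=> hy; apply: (gm_homog s); apply: trace_homog. Qed.

Lemma strace_act (a : A) (n : coinvMod Y) :
  strace (a ∗ (coinv_val n : Y)) = trace (a : regular) ∗ (coinv_val (s n) : X).
Proof.
rewrite /strace; have -> : traceC (a ∗ (coinv_val n : Y)) = traceB a • n.
  by apply: val_inj; apply: trace_act_coinv; apply: coinv_valP.
by rewrite (gmh_act s).
Qed.

Definition extend (y : Y) : X :=
  teval (fun h y' => theta h ∗ strace y' : X) (coact (hm_comod Y) y).

Let extend_bilin : bilin (fun h y' => theta h ∗ strace y' : X).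
Proof. exact: (bilin_comp (hact_bilin X) theta_linear strace_linear). Qed.

Lemma extend_linear : linear extend.
Proof. exact: (teval_coact_linear (M := hm_comod Y) extend_bilin). Qed.

Lemma extend_homog g y : homog g y -> homog g (linear_of extend_linear y).
Proof.
move=> hy; have := gm_homog (coact (hm_comod Y)) hy.
apply: (gbtens_homog_map (c := id)); first exact: teval_lin.
move=> g' h x y' hx hy'; rewrite teval_pure //.
by apply: mod_act_homog; [apply: gm_homog|apply: strace_homog].
Qed.

Lemma extend_coinv (a : A) (n : coinvMod Y) :
  extend (a ∗ (coinv_val n : Y)) = a ∗ (coinv_val (s n) : X).
Proof.
rewrite /extend coact_act_coinv; last exact: coinv_valP.
rewrite teval_tmap //; last exact: (hact_bilin Y).1.
(* On the right, a is expanded into the sum of θ(a_(-1)) t(a_(0)). *)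
rewrite -{2}(theta_trace (a : regular)).
rewrite (linear_teval _ _ ((hact_bilin X).1 _)); apply: eq_teval => h a'.
by rewrite strace_act -mod_actA.
Qed.

(** Expanding y by [theta_trace] makes a y a sum of terms (a θ(y_(-1))) n with n = t(y_(0))
    coinvariant, where [extend_coinv] gives the value. *)
Lemma extend_act (a : cA_alg A) (y : hm_mod Y) :
  GMap extend_homog (a • y) = a • (GMap extend_homog y : hm_mod X).
Proof.
rewrite /= -{1}(theta_trace (y : Y)).
have lX := (hact_bilin X).2 a; have lY := (hact_bilin Y).2 a.
rewrite [a • _](linear_teval _ _ lY) (linear_teval _ _ extend_linear).
rewrite [RHS](linear_teval _ _ lX); apply: eq_teval => h y'.
by rewrite -!mod_actA (extend_coinv _ (traceC y')).
Qed.

(** As s(t(y_(0))) is coinvariant, the coaction sees only θ(y_(-1)); colinearity of θ turns it into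
    Δ(y_(-1)), and coassociativity of Y does the rest. *)
Lemma extend_colinear :
  colinear (M := hm_comod Y) (N := hm_comod X) (GMap extend_homog).
Proof.
move=> y; rewrite /= (linear_teval _ _ (@coact_linear _ _ _ _ (hm_comod X))).
pose T (h x : H) (y' : Y) : H ⊠ X := h ⊗ (theta x ∗ strace y' : X).
have [t1 t2] := gtens_bilin H X; have [b1 b2] := extend_bilin.
transitivity (teval (fun h y' => teval (fun x1 x2 => T x1 x2 y') (comul H h))
  (coact (hm_comod Y) y)).
  apply: eq_teval => h y'; rewrite coact_act_coinv; last exact: strace_coinv.
  rewrite [coact _ _]theta_colinear {1}/tmap teval_tmap //.
    by apply: tmap_bilin => //; apply: (hact_bilin X).1.
  exact: theta_linear.
rewrite -(coact_coassoc (M := hm_comod Y)); last first.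
  split=> [x y'|h y'|h x]; first exact: t1.
    exact: linear_comp (t2 h) (b1 y').
  exact: linear_comp (t2 h) (b2 x).
by apply: eq_teval => h y'; rewrite -(linear_teval _ _ (t2 h)).
Qed.

Definition extend_hom : hopfHom Y X :=
  @HopfHom _ _ _ _ _ Y X (GMap extend_homog) extend_act extend_colinear.

End Extension.

Lemma coinv_dual_Maschke : is_alg_map (A := H) (B := cA_alg A) theta ->
  dual_Maschke (coinvFunctor A).
Proof.
move=> ta P X Y p [s ps] f; exists (hopfHom_comp (extend_hom ta s) f).
apply: hopfHom_eq => z /=; move: (f z) => y; rewrite /extend.
have lp : linear p by exact: linearP.
rewrite (linear_teval _ _ lp) -[RHS](theta_trace ta); apply: eq_teval => h y'.
rewrite [LHS](hh_act p); congr (_ ∗ _).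
(* The identity p s = id on coinvariants, evaluated at the trace of y'. *)
have := congr1 (fun e : gmodHom (coinvMod Y) (coinvMod Y) =>
  coinv_val (e (traceC y'))) ps.
by [].
Qed.

End TotalIntegral.

Theorem corollary3p18 (k : fieldType) (G : groupType)
  (Gab : forall g h : G, (g * h)%g = (h * g)%g)
  (chi : bicharacter k G) (H : colourHopf chi) (A : comodAlg H)
  (theta : gmap H A)
  (theta_colinear : colinear (M := Hcomod H) (N := cA_comod A) theta)
  (theta1 : theta (cone H) = cone (cA_alg A)) :
  Maschke (indFunctor A) /\
  (is_alg_map (A := H) (B := cA_alg A) theta -> dual_Maschke (coinvFunctor A)).
Proof.
split; first exact: ind_Maschke theta_colinear theta1.
exact: coinv_dual_Maschke theta_colinear theta1.
Qed.
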